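(* Let $A$ be the $3\times3$ Jordan block with eigenvalue $0$ (ones on the superdiagonal, zeros elsewhere), and let $\Omega$ be the disk centered at the origin of radius $r$ with $0<r\le1$. Parametrize $\partial\Omega$ by arc length as $\sigma(s)=re^{is/r}$, $s\in[0,2\pi r]$, define the Hermitian matrix \[ \mu(\sigma(s),A)=\frac{\sigma'(s)}{2\pi i}(\sigma(s)I-A)^{-1}+\left[\frac{\sigma'(s)}{2\pi i}(\sigma(s)I-A)^{-1}\right]^{*}, \] and set $\delta=-\int_0^{2\pi r}\lambda_{\min}(\mu(\sigma(s),A))\,ds$, where $\lambda_{\min}$ denotes the smallest eigenvalue. Then \[ \max_{f}\frac{\|f(A)\|}{\|f\|_\Omega}=2+\delta, \] the maximum being over all nonzero functions $f$ analytic in $\Omega$ and continuous on its closure, with $\|f\|_\Omega=\sup_{z\in\Omega}|f(z)|$.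
   Context: $\|\cdot\|$ is the matrix 2-norm. *)

(* Defs.v *)
From HB Require Import structures.
From mathcomp Require Import all_boot all_order all_algebra.
From mathcomp Require Import all_classical all_reals all_analysis.
From mathcomp Require Import complex.
Import numFieldNormedType.Exports.

Set Implicit Arguments.
Unset Strict Implicit.
Unset Printing Implicit Defensive.

Import Order.TTheory GRing.Theory Num.Theory.
Local Open Scope ring_scope.
Local Open Scope classical_set_scope.

Section Defs.
Variable R : realType.
Local Notation C := (R[i]).

Definition cabs (z : C) : R := Num.sqrt (complex.Re z ^+ 2 + complex.Im z ^+ 2).

Definition vnorm (n : nat) (x : 'cV[C]_n) : R :=
  Num.sqrt (\sum_(i < n) (complex.Re (x i 0) ^+ 2 + complex.Im (x i 0) ^+ 2)).

Definition opnorm (m n : nat) (M : 'M[C]_(m, n)) : R :=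
  sup [set vnorm (M *m x) | x in [set x : 'cV[C]_n | vnorm x = 1]].

Definition ctrmx (m n : nat) (M : 'M[C]_(m, n)) : 'M[C]_(n, m) :=
  (map_mx Num.conj M)^T.

Definition jordan_block (n : nat) (lam : C) : 'M[C]_n :=
  \matrix_(i, j) (if i == j then lam else if (j == i.+1 :> nat) then 1 else 0).

Definition cderiv (f : C^o -> C^o) : C^o -> C^o := fun z => derive1 f z.
Definition cderivn (k : nat) (f : C^o -> C^o) : C^o -> C^o := iter k cderiv f.

(* f(J_n(lam)) by the standard (Jordan form / Taylor) definition of a
   matrix function: entry (i,j) is f^(j-i)(lam)/(j-i)! for i <= j, else 0 *)
Definition matfun_jordan (f : C^o -> C^o) (n : nat) (lam : C) : 'M[C]_n :=
  \matrix_(i, j) (if (i <= j)%N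
                  then cderivn (j - i) f lam / ((j - i)`!)%:R
                  else 0).

Definition odisk (r : R) : set C^o := [set z | cabs z < r].
Definition cdisk (r : R) : set C^o := [set z | cabs z <= r].

Definition admissible (r : R) (f : C^o -> C^o) : Prop :=
  (forall z : C, odisk r z -> derivable f z 1) /\
  {within cdisk r, continuous f}.

Definition supnorm (r : R) (f : C^o -> C^o) : R :=
  sup [set cabs (f z) | z in odisk r].

Definition sigma (r : R) (s : R) : C :=
  ((r * cos (s / r)) +i* (r * sin (s / r)))%C.
Definition dsigma (r : R) (s : R) : C :=
  ((derive1 (fun t => complex.Re (sigma r t)) s) +i*
   (derive1 (fun t => complex.Im (sigma r t)) s))%C.

Definition mu_mx (n : nat) (r : R) (A : 'M[C]_n) (s : R) : 'M[C]_n :=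
  let M := (dsigma r s / (2 * (pi%:C)%C * 'i%C)) *: invmx (sigma r s *: 1%:M - A) in
  M + ctrmx M.

(* smallest eigenvalue of a Hermitian matrix (its eigenvalues are real) *)
Definition lambda_min (n : nat) (H : 'M[C]_n) : R :=
  inf [set x : R | eigenvalue H (x%:C)%C].

Definition delta (n : nat) (r : R) (A : 'M[C]_n) : R :=
  - Rintegral lebesgue_measure `[0, 2 * pi * r]
      (fun s => lambda_min (mu_mx r A s)).

End Defs.

(* Main.v *)
(** Conjugating the integrand by a diagonal unitary shows that [lambda_min] is
    constant along the circle, equal to [(2 - 1/r^2) / (2 pi r)] because [r <= 1];
    hence [2 + delta = 1/r^2], which [z^2] attains.  Conversely, if [|f| <= M] then
    [f(A) = D T D^-1] with [D = diag(1, r, r^2)] and [T] the Toeplitz matrix of the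
    coefficients [c_k r^k]; Bessel's inequality for [f p], [deg p <= 2], gives
    [|T| <= M], so [|f(A)| <= M / r^2].  Since [f] is only assumed differentiable at
    each point, the Cauchy formula is obtained from Goursat's bisection argument, in
    the coordinates [w + exp(- x^2) (rho e^(i t) - w)] shrinking a circle to [w]. *)
Require Import Defs.
From HB Require Import structures.
From mathcomp Require Import all_boot all_order all_algebra.
From mathcomp Require Import all_classical all_reals all_analysis.
From mathcomp Require Import complex ring lra.
Import numFieldNormedType.Exports.
Import Order.TTheory GRing.Theory Num.Theory.
Local Open Scope ring_scope.
Local Open Scope classical_set_scope.
Set Implicit Arguments.
Unset Strict Implicit.
Unset Printing Implicit Defensive.

(** * Complex modulus and continuity *)

Section ComplexModulus.
Variable R : realType.
Implicit Types z w : R[i].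

(** The hypothesis [r <= 1] decides both sides. If an eigenvalue is written [(2 + k) / (2 pi r)],
    then either [k = - 1/r^2], with eigenvector [(1, 0, -1)] after the conjugation, or
    [k (k - 1/r^2) = 2/r^2]; the roots of the latter do not fall below [- 1/r^2] exactly when
    [r <= 1]. On the other side, [r^-2] is the condition number of [diag(1, r, r^2)] for the same
    range of [r]. The bound on [T] must be sharp, whereas estimating an integral through its real
    and imaginary parts loses a factor 2. Such estimates therefore serve only for quantities that
    tend to 0, and the bound on [T] rests on the positivity of a mean. Means are taken on circles of
    radius [rho < r], and [rho] tends to [r] only in a final real inequality. Since [f(A)] is
    defined by iterated derivatives, the [c_k] have to be identified with [f(0)], [f'(0)] and
    [f''(0) / 2]; the last one requires a first-order expansion of [f'] at 0, although only the
    existence of [f'] is given. *)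

Lemma normcE_cabs z : `|z| = (cabs z)%:C%C.
Proof. by rewrite normc_def. Qed.

Lemma cabs_ge0 z : 0 <= cabs z.
Proof. exact: sqrtr_ge0. Qed.

Lemma cabsM z w : cabs (z * w) = cabs z * cabs w.
Proof. by apply: complexI; rewrite rmorphM /= -!normcE_cabs normrM. Qed.

Lemma cabsD z w : cabs (z + w) <= cabs z + cabs w.
Proof. by rewrite -lecR rmorphD /= -!normcE_cabs ler_normD. Qed.

Lemma cabsN z : cabs (- z) = cabs z.
Proof. by apply: complexI; rewrite -!normcE_cabs normrN. Qed.

Lemma cabsB z w : cabs (z - w) <= cabs z + cabs w.
Proof. by rewrite (le_trans (cabsD _ _)) // cabsN. Qed.

Lemma cabs_distC z w : cabs (z - w) = cabs (w - z).
Proof. by rewrite -cabsN opprB. Qed.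

Lemma cabsV z : cabs z^-1 = (cabs z)^-1.
Proof.
by apply: complexI; rewrite -normcE_cabs normfV normcE_cabs -fmorphV.
Qed.

Lemma cabsX z n : cabs (z ^+ n) = cabs z ^+ n.
Proof. by apply: complexI; rewrite rmorphXn /= -!normcE_cabs normrX. Qed.

Lemma cabs0 : cabs (0 : R[i]) = 0.
Proof. by apply: complexI; rewrite -normcE_cabs normr0. Qed.

Lemma cabs1 : cabs (1 : R[i]) = 1.
Proof. by apply: complexI; rewrite -normcE_cabs normr1. Qed.

Lemma cabs_eq0 z : (cabs z == 0) = (z == 0).
Proof.
by rewrite -[RHS]normr_eq0 normcE_cabs -(inj_eq (@complexI R)).
Qed.

Lemma cabs_gt0 z : (0 < cabs z) = (z != 0).
Proof. by rewrite lt_neqAle cabs_ge0 andbT eq_sym cabs_eq0. Qed.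

Lemma cabs_real (x : R) : cabs (x%:C)%C = `|x|.
Proof. by rewrite /cabs /= expr0n addr0 sqrtr_sqr. Qed.

Lemma cabs_sqr z : cabs z ^+ 2 = complex.Re z ^+ 2 + complex.Im z ^+ 2.
Proof. by rewrite sqr_sqrtr // addr_ge0 // sqr_ge0. Qed.

Lemma cabs_i : cabs ('i%C : R[i]) = 1.
Proof. by rewrite /cabs /= expr0n expr1n add0r sqrtr1. Qed.

Lemma Re_le_cabs z : `|complex.Re z| <= cabs z.
Proof.
rewrite -(@ler_pXn2r _ 2) ?nnegrE ?normr_ge0 ?cabs_ge0 //.
by rewrite cabs_sqr real_normK ?num_real // lerDl sqr_ge0.
Qed.

Lemma Im_le_cabs z : `|complex.Im z| <= cabs z.
Proof.
rewrite -(@ler_pXn2r _ 2) ?nnegrE ?normr_ge0 ?cabs_ge0 //.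
by rewrite cabs_sqr real_normK ?num_real // lerDr sqr_ge0.
Qed.

Lemma cabs_le_ReIm z : cabs z <= `|complex.Re z| + `|complex.Im z|.
Proof.
rewrite -(@ler_pXn2r _ 2) ?nnegrE ?addr_ge0 ?normr_ge0 ?cabs_ge0 //.
rewrite cabs_sqr sqrrD !real_normK ?num_real // lerD2r lerDl.
by rewrite mulrn_wge0 // mulr_ge0.
Qed.

Lemma mulcJ z : z * z^*%C = ((cabs z ^+ 2)%:C)%C.
Proof. by rewrite -sqr_normc normcE_cabs rmorphXn. Qed.

Lemma cabsJ z : cabs z^*%C = cabs z.
Proof. by apply: complexI; rewrite -!normcE_cabs normcJ. Qed.

Lemma cabs_le_sub z w : cabs z - cabs w <= cabs (z - w).
Proof. by rewrite lerBlDr (le_trans _ (cabsD _ _)) // subrK. Qed.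

Lemma ReB z w : complex.Re (z - w) = complex.Re z - complex.Re w.
Proof. by case: z; case: w. Qed.
Lemma ReD z w : complex.Re (z + w) = complex.Re z + complex.Re w.
Proof. by case: z; case: w. Qed.
Lemma ImB z w : complex.Im (z - w) = complex.Im z - complex.Im w.
Proof. by case: z; case: w. Qed.
Lemma ImD z w : complex.Im (z + w) = complex.Im z + complex.Im w.
Proof. by case: z; case: w. Qed.
Lemma ReM z w : complex.Re (z * w) =
  complex.Re z * complex.Re w - complex.Im z * complex.Im w.
Proof. by case: z; case: w. Qed.
Lemma ImM z w : complex.Im (z * w) =
  complex.Re z * complex.Im w + complex.Im z * complex.Re w.
Proof. by case: z; case: w. Qed.

Lemma complex_eqP z w :
  complex.Re z = complex.Re w -> complex.Im z = complex.Im w -> z = w.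
Proof. by case: z => a b; case: w => c d /= -> ->. Qed.
End ComplexModulus.

Section ComplexContinuity.
Variable R : realType.

(** The norm of [R[i]] takes its values in [R[i]], so the generic notion of limit quantifies over
    complex radii; this form keeps every epsilon real. *)
Definition ccont (u : R -> R[i]) : Prop :=
  forall x (e : R), 0 < e -> exists2 d : R, 0 < d &
     forall y, `|y - x| < d -> cabs (u y - u x) < e.

Lemma ccontE (u : R -> R[i]) : ccont u <-> continuous (u : R -> R[i]^o).
Proof.
split=> [H x|cu x e e0].
  apply/cvgrPdist_lt => e e0.
  have [a /andP[ea a0]] : exists a : R, (e == (a%:C)%C) && (0 < a).
    exists (complex.Re e); case: e e0 => a b /=.
    by rewrite ltcE /= => /andP[/eqP -> ->]; rewrite eqxx.
  have [d d0 Hd] := H x a a0.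
  apply/nbhs_ballP; exists d => //= y; rewrite /ball /= distrC => yx.
  by rewrite (eqP ea) -normrN opprB normcE_cabs ltcR; exact: Hd.
have /cvgrPdist_lt/(_ (e%:C)%C) := cu x.
rewrite ltcR => /(_ e0) /nbhs_ballP[d /= d0 H]; exists d => // y yx.
have := H y; rewrite /ball /= distrC => /(_ yx).
by rewrite -normrN opprB normcE_cabs ltcR.
Qed.

Lemma ccont_Re u : ccont u -> continuous (fun x => complex.Re (u x)).
Proof.
move=> cu x; apply/cvgrPdist_lt => e e0.
have [d d0 H] := cu x e e0; apply/nbhs_ballP; exists d => //= y.
rewrite /ball /= distrC => /H; apply: le_lt_trans.
by rewrite -ReB cabs_distC Re_le_cabs.
Qed.

Lemma ccont_Im u : ccont u -> continuous (fun x => complex.Im (u x)).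
Proof.
move=> cu x; apply/cvgrPdist_lt => e e0.
have [d d0 H] := cu x e e0; apply/nbhs_ballP; exists d => //= y.
rewrite /ball /= distrC => /H; apply: le_lt_trans.
by rewrite -ImB cabs_distC Im_le_cabs.
Qed.

Lemma ccontD (u v : R -> R[i]) : ccont u -> ccont v -> ccont (fun x => u x + v x).
Proof.
move=> /ccontE cu /ccontE cv; apply/ccontE => x; apply: (@cvgD _ R[i]^o); [exact: cu|exact: cv].
Qed.

Lemma ccontN (u : R -> R[i]) : ccont u -> ccont (fun x => - u x).
Proof.
move=> /ccontE cu; apply/ccontE => x; apply: (@cvgN _ R[i]^o); exact: cu.
Qed.

Lemma ccontB (u v : R -> R[i]) : ccont u -> ccont v -> ccont (fun x => u x - v x).
Proof. by move=> cu cv; exact: ccontD cu (ccontN cv). Qed.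

Lemma ccontM (u v : R -> R[i]) : ccont u -> ccont v -> ccont (fun x => u x * v x).
Proof.
move=> /ccontE cu /ccontE cv; apply/ccontE => x; apply: (@cvgM R[i]); [exact: cu|exact: cv].
Qed.

Lemma ccont_cst (c : R[i]) : ccont (fun=> c).
Proof.
apply/ccontE => x; exact: cvg_cst.
Qed.

Lemma ccontV (u : R -> R[i]) : (forall x, u x != 0) -> ccont u ->
  ccont (fun x => (u x)^-1).
Proof.
move=> u0 /ccontE cu; apply/ccontE => x; apply: (@cvgV R[i]); [exact: u0|exact: cu].
Qed.

Lemma ccontX (u : R -> R[i]) n : ccont u -> ccont (fun x => u x ^+ n).
Proof.
move=> cu; elim: n => [|n IH]; first exact: ccont_cst.
by under eq_fun do rewrite exprS; exact: ccontM.
Qed.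

Lemma ccont_ReIm (a b : R -> R) : continuous a -> continuous b ->
  ccont (fun x => (a x +i* b x)%C).
Proof.
move=> ca cb; move=> x e e0.
have e2 : 0 < e / 2 by rewrite divr_gt0.
have /cvgrPdist_lt/(_ _ e2)/nbhs_ballP[d1 /= d10 H1] := ca x.
have /cvgrPdist_lt/(_ _ e2)/nbhs_ballP[d2 /= d20 H2] := cb x.
exists (Num.min d1 d2); first by rewrite lt_min d10 d20.
move=> y; rewrite lt_min => /andP[y1 y2].
apply: (le_lt_trans (cabs_le_ReIm _)) => /=.
have := H1 y; have := H2 y; rewrite /ball /= ![`|x - y|]distrC.
move=> /(_ y2) h2 /(_ y1) h1; rewrite (splitr e) distrC.
by apply: ltrD => //; rewrite distrC.
Qed.

Lemma ccontJ u : ccont u -> ccont (fun x => (u x)^*%C).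
Proof.
move=> cu.
have -> : (fun x => (u x)^*%C) =
    (fun x => (complex.Re (u x) +i* - complex.Im (u x))%C).
  by apply/funext => x; case: (u x).
apply: ccont_ReIm; first exact: ccont_Re.
by move=> x; apply: cvgN; exact: ccont_Im.
Qed.

Lemma eq_ccont (u v : R -> R[i]) : (forall x, u x = v x) -> ccont u -> ccont v.
Proof. by move=> uv; have -> : v = u by apply/funext => x; rewrite uv. Qed.

Lemma ccont_real (a : R -> R) : continuous a -> ccont (fun x => (a x)%:C%C).
Proof. by move=> ca; apply: ccont_ReIm => // x; exact: cvg_cst. Qed.

End ComplexContinuity.

(** * Integration of complex-valued functions *)

Section Primitive.
Variable R : realType.

Lemma derive0_eq (D : R -> R) (c a b : R) : c < a -> c < b ->
  (forall x, c < x -> is_derive x 1 D 0) -> D a = D b.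
Proof.
suff H x y : c < x -> x <= y -> (forall x, c < x -> is_derive x 1 D 0) -> D x = D y.
  move=> ca cb HD; have [ab|/ltW ba] := leP a b; first exact: H.
  by apply/esym; exact: H.
move=> cx; rewrite le_eqVlt => /predU1P[->//|xy] HD.
have [||t _ ] := @MVT R D (fun=> 0) x y xy.
- by move=> t; rewrite in_itv /= => /andP[xt _]; apply: HD; exact: lt_trans xt.
- apply: derivable_within_continuous => t; rewrite in_itv /= => /andP[xt _].
  by apply: ex_derive; apply: HD; exact: lt_le_trans xt.
- by rewrite mul0r => /eqP; rewrite subr_eq0 => /eqP.
Qed.

Lemma primitive_right (u : R -> R) (c : R) : continuous u ->
  exists P : R -> R, forall x : R, c < x -> is_derive x 1 P (u x).
Proof.
move=> cu; exists (fun x => \int[lebesgue_measure]_(t in `[c, x]) u t)%R => x cx.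
have [||||dF FE] := @continuous_FTC1_closed R u c x (x + 1).
- by rewrite ltrDl.
- apply: continuous_compact_integrable; first exact: segment_compact.
  exact: continuous_subspaceT.
- exact: cx.
- exact: cu.
by apply: (DeriveDef dF); rewrite -derive1E; exact: FE.
Qed.

(** An integral from [c] is a primitive only to the right of [c]. Two of them differ by a constant,
    so subtracting the value at 0 makes them agree; the base point [N x], below both [x] and 0, then
    covers the whole line. *)
Lemma primitive_exists (u : R -> R) : continuous u ->
  exists P : R -> R, forall x : R, is_derive x 1 P (u x).
Proof.
move=> cu; have /choice[G HG] := fun c => primitive_right c cu.
pose N (x : R) : R := - `|x| - 1.
have NN x : N x < x /\ N x < 0.
  rewrite /N; have := ler_norm (- x); rewrite normrN; have := normr_ge0 x.
  by move=> *; split; lra.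
have GE c x : c < x -> c < 0 -> G (N x) x - G (N x) 0 = G c x - G c 0.
  move=> cx c0; have [Nx N0] := NN x.
  have := @derive0_eq (G (N x) \- G c) (Num.max (N x) c) x 0.
  rewrite !gt_max Nx N0 cx c0 => /(_ isT isT).
  have H : forall y, Num.max (N x) c < y -> is_derive y 1 (G (N x) \- G c) 0.
    move=> y; rewrite gt_max => /andP[y1 y2].
    by rewrite -(subrr (u y)); apply: is_deriveB; exact: HG.
  by move=> /(_ H) /=; lra.
exists (fun x => G (N x) x - G (N x) 0) => x.
have [Nx N0] := NN x.
have : is_derive x 1 (G (N x) \- cst (G (N x) 0)) (u x - 0).
  by apply: is_deriveB; exact: HG.
rewrite subr0; apply: near_eq_is_derive.
near=> y; rewrite /= (GE (N x)) //.
by near: y; exact: lt_nbhsr.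
Unshelve. all: end_near. Qed.
End Primitive.

Section ComplexIntegral.
Variable R : realType.
Implicit Types (u v U V : R -> R[i]) (a b c : R).

Definition prim (u : R -> R) : R -> R :=
  xget (fun=> 0) [set P : R -> R | forall x : R, is_derive x 1 P (u x)].

Lemma primP (u P : R -> R) : (forall x : R, is_derive x 1 P (u x)) ->
  forall x : R, is_derive x 1 (prim u) (u x).
Proof.
move=> HP; exact: (@xgetPex _ (fun=> 0)
  [set P : R -> R | forall x : R, is_derive x 1 P (u x)] (ex_intro _ P HP)).
Qed.

Lemma primB (u P : R -> R) (a b : R) : (forall x : R, is_derive x 1 P (u x)) ->
  prim u b - prim u a = P b - P a.
Proof.
move=> HP; have Hu := primP HP.
have : (prim u \- P) b = (prim u \- P) a.
  apply: is_derive_0_is_cst => x.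
  by rewrite -(subrr (u x)); exact: is_deriveB.
by move=> /=; lra.
Qed.

(* Integrals are increments of a primitive: additivity in the interval is then an
   identity, and everything else follows from [cint_FTC].  The value is junk when
   [u] has no primitive. *)
Definition cint u a b : R[i] :=
  ((prim (fun x => complex.Re (u x)) b - prim (fun x => complex.Re (u x)) a) +i*
   (prim (fun x => complex.Im (u x)) b - prim (fun x => complex.Im (u x)) a))%C.

Definition cder V u : Prop := forall x : R,
  is_derive x 1 (fun x => complex.Re (V x)) (complex.Re (u x)) /\
  is_derive x 1 (fun x => complex.Im (V x)) (complex.Im (u x)).

Lemma cint_FTC u V a b : cder V u -> cint u a b = V b - V a.
Proof.
move=> HV; apply: complex_eqP; rewrite ?ReB ?ImB /=.
- by apply: (@primB _ (fun x => complex.Re (V x))) => x; exact: (HV x).1.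
- by apply: (@primB _ (fun x => complex.Im (V x))) => x; exact: (HV x).2.
Qed.

Lemma ccont_cder u : ccont u -> exists V, cder V u.
Proof.
move=> cu; have [P HP] := primitive_exists (ccont_Re cu).
have [Q HQ] := primitive_exists (ccont_Im cu).
by exists (fun x => (P x +i* Q x)%C) => x; split; [exact: HP|exact: HQ].
Qed.

Lemma cderD U u V v : cder U u -> cder V v ->
  cder (fun x => U x + V x) (fun x => u x + v x).
Proof.
move=> HU HV x; have [U1 U2] := HU x; have [V1 V2] := HV x; rewrite ReD ImD; split.
- have -> : (fun x => complex.Re (U x + V x)) =
    (fun x => complex.Re (U x)) \+ (fun x => complex.Re (V x)).
    by apply/funext => t; rewrite ReD.
  exact: is_deriveD.
- have -> : (fun x => complex.Im (U x + V x)) =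
    (fun x => complex.Im (U x)) \+ (fun x => complex.Im (V x)).
    by apply/funext => t; rewrite ImD.
  exact: is_deriveD.
Qed.

Lemma cderZ (k : R[i]) U u : cder U u -> cder (fun x => k * U x) (fun x => k * u x).
Proof.
move=> HU x; have [U1 U2] := HU x; rewrite ReM ImM; split.
- have -> : (fun x => complex.Re (k * U x)) =
    (complex.Re k \*: (fun x => complex.Re (U x) : R^o)) \-
    (complex.Im k \*: (fun x => complex.Im (U x) : R^o)).
    by apply/funext => t; rewrite ReM.
  by apply: is_deriveB; exact: is_deriveZ.
- have -> : (fun x => complex.Im (k * U x)) =
    (complex.Re k \*: (fun x => complex.Im (U x) : R^o)) \+
    (complex.Im k \*: (fun x => complex.Re (U x) : R^o)).
    by apply/funext => t; rewrite ImM.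
  by apply: is_deriveD; exact: is_deriveZ.
Qed.

Lemma cderJ U u : cder U u -> cder (fun x => (U x)^*%C) (fun x => (u x)^*%C).
Proof.
move=> HU x; have [U1 U2] := HU x; split.
- have -> : (fun x => complex.Re (U x)^*%C) = (fun x => complex.Re (U x)).
    by apply/funext => t; case: (U t).
  by case: (u x) U1.
- have -> : (fun x => complex.Im (U x)^*%C) = \- (fun x => complex.Im (U x)).
    by apply/funext => t /=; case: (U t).
  have -> : complex.Im (u x)^*%C = - complex.Im (u x) by case: (u x).
  exact: is_deriveN.
Qed.

Lemma cint_chasles u a b c : cint u a b = cint u a c + cint u c b.
Proof. by apply: complex_eqP; rewrite ?ReD ?ImD /=; ring. Qed.

Lemma cintD u v a b : ccont u -> ccont v ->
  cint (fun x => u x + v x) a b = cint u a b + cint v a b.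
Proof.
move=> /ccont_cder[U HU] /ccont_cder[V HV].
by rewrite (cint_FTC _ _ (cderD HU HV)) (cint_FTC _ _ HU) (cint_FTC _ _ HV); ring.
Qed.

Lemma cintZ (k : R[i]) u a b : ccont u ->
  cint (fun x => k * u x) a b = k * cint u a b.
Proof.
move=> /ccont_cder[U HU].
by rewrite (cint_FTC _ _ (cderZ k HU)) (cint_FTC _ _ HU); ring.
Qed.

Lemma cintB u v a b : ccont u -> ccont v ->
  cint (fun x => u x - v x) a b = cint u a b - cint v a b.
Proof.
move=> cu cv; have -> : (fun x => u x - v x) = (fun x => u x + (-1) * v x).
  by apply/funext => x; ring.
rewrite cintD //; last by apply: ccontM => //; exact: ccont_cst.
by rewrite cintZ //; ring.
Qed.

Lemma cintJ u a b : ccont u -> cint (fun x => (u x)^*%C) a b = (cint u a b)^*%C.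
Proof.
move=> /ccont_cder[U HU].
by rewrite (cint_FTC _ _ (cderJ HU)) (cint_FTC _ _ HU) rmorphB.
Qed.

Lemma MVT_le (P p : R -> R) (K a b : R) : a <= b ->
  (forall x : R, is_derive x 1 P (p x)) ->
  (forall x, a <= x <= b -> `|p x| <= K) -> `|P b - P a| <= K * (b - a).
Proof.
move=> ab HP HK.
have cP : {within `[a, b], continuous P}.
  by apply: derivable_within_continuous => x _; exact: ex_derive.
have [c cab ->] := MVT_segment ab (fun x _ => HP x) cP.
by rewrite normrM [`|b - a|]ger0_norm ?subr_ge0 // ler_wpM2r ?subr_ge0 // HK.
Qed.

(** The mean value theorem applies to the real and imaginary parts separately, whence the factor 2.
    Where a sharp constant matters, [Re_cint_ge0] is used instead. *)
Lemma cder_le V u (K a b : R) : a <= b -> cder V u ->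
  (forall x, a <= x <= b -> cabs (u x) <= K) -> cabs (V b - V a) <= 2 * K * (b - a).
Proof.
move=> ab HV HK; apply: (le_trans (cabs_le_ReIm _)).
rewrite ReB ImB -mulrA mulrDl mul1r lerD //.
- apply: (@MVT_le (fun x => complex.Re (V x)) (fun x => complex.Re (u x))) => // x.
    exact: (HV x).1.
  by move=> /HK; apply: le_trans; exact: Re_le_cabs.
- apply: (@MVT_le (fun x => complex.Im (V x)) (fun x => complex.Im (u x))) => // x.
    exact: (HV x).2.
  by move=> /HK; apply: le_trans; exact: Im_le_cabs.
Qed.

Lemma cint_le u (K a b : R) : a <= b -> ccont u ->
  (forall x, a <= x <= b -> cabs (u x) <= K) -> cabs (cint u a b) <= 2 * K * (b - a).
Proof.
by move=> ab /ccont_cder[U HU] HK; rewrite (cint_FTC _ _ HU); exact: cder_le HK.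
Qed.

Lemma Re_cint_ge0 u a b : a <= b -> ccont u ->
  (forall x, 0 <= complex.Re (u x)) -> 0 <= complex.Re (cint u a b).
Proof.
move=> ab /ccont_cder[U HU] H; rewrite (cint_FTC _ _ HU) ReB.
have cU : {within `[a, b], continuous (fun x => complex.Re (U x))}.
  by apply: derivable_within_continuous => x _; apply: ex_derive; exact: (HU x).1.
have [c cab ->] := MVT_segment ab (fun x _ => (HU x).1) cU.
by rewrite mulr_ge0 // subr_ge0.
Qed.

End ComplexIntegral.

(** * Goursat's theorem *)

Section Bisection.
Variable R : realType.

Lemma nested_intervals (lo hi : nat -> R) :
  (forall n, lo n <= lo n.+1) -> (forall n, hi n.+1 <= hi n) ->
  (forall n, lo n <= hi n) -> exists x, forall n, lo n <= x <= hi n.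
Proof.
move=> lo_incr hi_decr lohi.
have lom m n : (m <= n)%N -> lo m <= lo n.
  by move=> /subnK <-; elim: (n - m)%N => //= k /le_trans; apply; rewrite addSn.
have him m n : (m <= n)%N -> hi n <= hi m.
  move=> /subnK <-; elim: (n - m)%N => //= k; apply: le_trans; rewrite addSn.
  exact: hi_decr.
have lh m n : lo m <= hi n.
  have [mn|/ltnW nm] := leqP m n; first exact: le_trans (lom _ _ mn) _.
  exact: le_trans (lohi _) (him _ _ nm).
exists (sup (range lo)) => n; apply/andP; split.
- apply: ub_le_sup; last by exists n.
  by exists (hi 0%N) => _ [m _ <-]; exact: lh.
- apply: ge_sup; first by exists (lo 0%N), 0%N.
  by move=> _ [m _ <-]; exact: lh.
Qed.

Lemma half_pow_small (h d : R) : 0 < d -> exists n0 : nat,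
  forall n, (n0 <= n)%N -> h / 2 ^+ n < d.
Proof.
move=> d0; exists (Num.truncn (h / d)).+1 => n Hn.
have p2 : 0 < 2 ^+ n :> R by rewrite exprn_gt0.
rewrite ltr_pdivrMr // mulrC -ltr_pdivrMr //.
apply: lt_le_trans (_ : n%:R <= _).
  apply: lt_le_trans (truncnS_gt _) _; by rewrite ler_nat.
by rewrite -natrX ler_nat ltnW // ltn_expl.
Qed.

(* Goursat's bisection argument, for an abstract additive function of rectangles. *)
Lemma additive_rectangle_eq0 (J : R -> R -> R -> R -> R[i]) :
  (forall m a b c d, J a b c d = J a m c d + J m b c d) ->
  (forall m a b c d, J a b c d = J a b c m + J a b m d) ->
  (forall x y e : R, 0 < e -> exists2 dt : R, 0 < dt & forall a b c d : R,
     a <= x <= b -> c <= y <= d -> b - a < dt -> d - c < dt ->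
     cabs (J a b c d) <= e * ((b - a) + (d - c)) ^+ 2) ->
  forall a b c d, a <= b -> c <= d -> J a b c d = 0.
Proof.
move=> Jx Jy Jloc a b c d ab cd.
pose h n : R := (b - a) / 2 ^+ n; pose k n : R := (d - c) / 2 ^+ n.
have hS n : h n = h n.+1 + h n.+1.
  by rewrite /h exprS; field; rewrite expf_neq0 ?pnatr_eq0.
have kS n : k n = k n.+1 + k n.+1.
  by rewrite /k exprS; field; rewrite expf_neq0 ?pnatr_eq0.
have h0 n : 0 <= h n by rewrite /h divr_ge0 ?subr_ge0 // exprn_ge0.
have k0 n : 0 <= k n by rewrite /k divr_ge0 ?subr_ge0 // exprn_ge0.
(* Modulus over the rectangle of generation [n] with lower corner [p]. One of its four quarters
   carries at least a quarter of it. *)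
pose K n (p : R * R) := cabs (J p.1 (p.1 + h n) p.2 (p.2 + k n)).
have step (np : nat * (R * R)) : exists q : R * R,
    [/\ np.2.1 <= q.1 <= np.2.1 + h np.1.+1,
        np.2.2 <= q.2 <= np.2.2 + k np.1.+1 &
        K np.1 np.2 <= 4 * K np.1.+1 q].
  case: np => n [x y] /=.
  pose q1 := (x, y); pose q2 := (x + h n.+1, y).
  pose q3 := (x, y + k n.+1); pose q4 := (x + h n.+1, y + k n.+1).
  have KD : K n (x, y) <= K n.+1 q1 + K n.+1 q2 + K n.+1 q3 + K n.+1 q4.
    rewrite /K /= hS kS !addrA (Jx (x + h n.+1)).
    rewrite (Jy (y + k n.+1) x) (Jy (y + k n.+1) (x + h n.+1)).
    have cabs4 (z1 z2 z3 z4 : R[i]) :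
        cabs (z1 + z3 + (z2 + z4)) <= cabs z1 + cabs z2 + cabs z3 + cabs z4.
      rewrite addrACA addrA; do 2 apply: (le_trans (cabsD _ _)) (lerD _ (lexx _)).
      exact: cabsD.
    exact: cabs4.
  have H0 := h0 n.+1; have K0 := k0 n.+1.
  have [?|l1] := leP (K n (x, y)) (4 * K n.+1 q1).
    by exists q1; split => //; rewrite ?lexx ?lerDl.
  have [?|l2] := leP (K n (x, y)) (4 * K n.+1 q2).
    by exists q2; split => //; rewrite ?lexx ?lerDl ?H0.
  have [?|l3] := leP (K n (x, y)) (4 * K n.+1 q3).
    by exists q3; split => //; rewrite ?lexx ?lerDl ?K0.
  have [?|l4] := leP (K n (x, y)) (4 * K n.+1 q4).
    by exists q4; split => //; rewrite ?lexx ?lerDl ?H0 ?K0.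
  lra.
have /choice[g Hg] := step.
pose s := fix s n := if n is m.+1 then g (m, s m) else (a, c).
have Ks n : K 0%N (a, c) <= 4 ^+ n * K n (s n).
  elim: n => [|n IH]; first by rewrite expr0 mul1r.
  apply: (le_trans IH); rewrite exprSr -mulrA ler_pM2l ?exprn_gt0 //.
  by have [_ _] := Hg (n, s n).
have [x Hx] : exists x, forall n, (s n).1 <= x <= (s n).1 + h n.
  apply: nested_intervals => n; last by rewrite lerDl.
  - by have [/andP[]] := Hg (n, s n).
  - by have [/andP[_ +] _ _] := Hg (n, s n); rewrite /= (hS n); lra.
have [y Hy] : exists y, forall n, (s n).2 <= y <= (s n).2 + k n.
  apply: nested_intervals => n; last by rewrite lerDl.
  - by have [_ /andP[]] := Hg (n, s n).
  - by have [_ /andP[_ +] _] := Hg (n, s n); rewrite /= (kS n); lra.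
apply/eqP; rewrite -cabs_eq0 eq_le cabs_ge0 andbT.
have -> : cabs (J a b c d) = K 0%N (a, c).
  by rewrite /K /h /k /= !expr0 !divr1 !subrKC.
apply/ler_addgt0Pr => e e0; rewrite add0r; set S := (b - a + (d - c)).
have S0 : 0 <= S by rewrite addr_ge0 ?subr_ge0.
have S1 : 0 < S ^+ 2 + 1 by rewrite ltr_wpDl ?sqr_ge0.
have [dt dt0 H] := Jloc x y (e / (S ^+ 2 + 1)) (divr_gt0 e0 S1).
have [n1 N1] := half_pow_small (b - a) dt0.
have [n2 N2] := half_pow_small (d - c) dt0.
pose n := maxn n1 n2.
have := H (s n).1 ((s n).1 + h n) (s n).2 ((s n).2 + k n) (Hx n) (Hy n).
have eh : (s n).1 + h n - (s n).1 = h n by ring.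
have ek : (s n).2 + k n - (s n).2 = k n by ring.
rewrite eh ek => /(_ (N1 n (leq_maxl _ _)) (N2 n (leq_maxr _ _))) HK.
apply: (le_trans (Ks n)).
apply: le_trans (_ : 4 ^+ n * (e / (S ^+ 2 + 1) * (h n + k n) ^+ 2) <= _).
  by rewrite ler_pM2l // exprn_gt0.
(* The factor [4 ^+ n] lost in [n] bisections is exactly regained from the square of the side
   lengths, hence the quadratic local hypothesis. *)
have -> : 4 ^+ n * (e / (S ^+ 2 + 1) * (h n + k n) ^+ 2) = e * (S ^+ 2 / (S ^+ 2 + 1)).
  have -> : 4 ^+ n = (2 ^+ n) ^+ 2 :> R.
    by rewrite -exprM mulnC exprM; congr (_ ^+ _); ring.
  rewrite /h /k /S; field; rewrite expf_neq0 ?pnatr_eq0 //=.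
  by rewrite andbT -/S; exact: lt0r_neq0.
rewrite -[leRHS]mulr1 ler_pM2l // ler_pdivrMr // mul1r lerDl //.
Qed.

End Bisection.

(** * Complex differentiability as a first-order expansion with real epsilons *)

Section ComplexDerivative.
Variable R : realType.
Implicit Types f : R[i]^o -> R[i]^o.

Lemma derivable_expand f (z : R[i]) : derivable (f : R[i]^o -> R[i]^o) z 1 ->
  forall e : R, 0 < e -> exists2 d : R, 0 < d & forall y : R[i],
    cabs (y - z) < d -> cabs (f y - f z - derive1 f z * (y - z)) <= e * cabs (y - z).
Proof.
move=> /cvg_ex[l Hl] e e0.
have -> : derive1 f z = l.
  rewrite derive1E /derive; apply: cvg_lim => //; exact: norm_hausdorff.
have /cvgrPdist_lt/(_ (e%:C)%C) := Hl.
rewrite ltcR => /(_ e0) /nbhs_ballP[d /= d0 H].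
have [a /andP[/eqP da a0]] : exists a : R, (d == (a%:C)%C) && (0 < a).
  exists (complex.Re d); case: d d0 {H} => a b /=.
  by rewrite ltcE /= => /andP[/eqP -> ->]; rewrite eqxx.
exists a => // y yz.
have [->|yz0] := eqVneq y z; first by rewrite !subrr mulr0 subr0 cabs0 mulr0.
have hy0 : y - z != 0 by rewrite subr_eq0.
have := H (y - z); rewrite /ball /= sub0r normrN normcE_cabs da ltcR => /(_ yz hy0).
rewrite -[_%:A]/((y - z) * 1) mulr1 subrK -[_ *: _]/((y - z)^-1 * (f y - f z)).
rewrite -normrN normcE_cabs ltcR opprB => /ltW H1.
have -> : f y - f z - l * (y - z) = ((y - z)^-1 * (f y - f z) - l) * (y - z).
  by field.
by rewrite cabsM ler_wpM2r ?cabs_ge0.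
Qed.

Lemma expand_derivable f (z l : R[i]) :
  (forall e : R, 0 < e -> exists2 d : R, 0 < d & forall y : R[i],
    cabs (y - z) < d -> cabs (f y - f z - l * (y - z)) <= e * cabs (y - z)) ->
  derivable (f : R[i]^o -> R[i]^o) z 1 /\ derive1 f z = l.
Proof.
move=> H; rewrite derive1E /derive /derivable.
suff cl : h^-1 *: ((f \o shift z) (h *: (1 : R[i]^o)) - f z) @[h --> (0 : R[i]^o)^'] -->
    (l : R[i]^o).
  split; first by apply/cvg_ex; exists l.
  by apply: cvg_lim cl; exact: norm_hausdorff.
apply/cvgrPdist_le => e e0.
have [a /andP[/eqP ea a0]] : exists a : R, (e == (a%:C)%C) && (0 < a).
  exists (complex.Re e); case: e e0 => a b /=.
  by rewrite ltcE /= => /andP[/eqP -> ->]; rewrite eqxx.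
have [d d0 Hd] := H a a0.
apply/nbhs_ballP; exists (d%:C)%C => /=; first by rewrite ltcR.
move=> h; rewrite /ball /= sub0r normrN normcE_cabs ltcR => hd h0.
have := Hd (h + z); rewrite addrK => /(_ hd) H1.
rewrite -[_%:A]/(h * 1) mulr1 -[_ *: _]/(h^-1 * (f (h + z) - f z)).
rewrite -normrN normcE_cabs ea lecR opprB.
have -> : h^-1 * (f (h + z) - f z) - l = (f (h + z) - f z - l * h) / h.
  by field.
by rewrite cabsM cabsV ler_pdivrMr // cabs_gt0.
Qed.

Lemma ccont_comp f (u : R -> R[i]) : (forall x, derivable f (u x) 1) -> ccont u ->
  ccont (fun x => f (u x)).
Proof.
move=> df cu x e e0.
have [d d0 Hd] := derivable_expand (df x) ltr01.
set l := cabs (derive1 f (u x)).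
have l1 : 0 < 1 + l by rewrite ltr_pwDl ?cabs_ge0.
have m0 : 0 < Num.min d (e / (1 + l)) by rewrite lt_min d0 divr_gt0.
have [c c0 Hc] := cu x _ m0; exists c => // y /Hc; rewrite lt_min => /andP[yd ye].
rewrite ltr_pdivlMr // in ye; apply: le_lt_trans ye.
have -> : f (u y) - f (u x) = (f (u y) - f (u x) - derive1 f (u x) * (u y - u x))
  + derive1 f (u x) * (u y - u x) by ring.
apply: (le_trans (cabsD _ _)); rewrite cabsM -/l.
by have := Hd _ yd; rewrite mul1r; lra.
Qed.
Lemma derivable_mulc f (g : R[i]^o -> R[i]^o) (z : R[i]) : derivable f z 1 -> derivable g z 1 ->
  derivable (fun y : R[i]^o => f y * g y : R[i]^o) z 1.
Proof. by move=> df dg; exact: (@derivableM R[i] R[i]^o f g z 1 df dg). Qed.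

Lemma derivable_powc (z : R[i]) n :
  derivable (fun y : R[i]^o => y ^+ n : R[i]^o) z 1.
Proof.
have := @derivableX R[i] R[i]^o id n z 1 (@derivable_id _ _ _ _).
by rewrite exprfctE.
Qed.

Lemma derivable_invc f (z : R[i]) : f z != 0 -> derivable f z 1 ->
  derivable (fun y : R[i]^o => (f y)^-1 : R[i]^o) z 1.
Proof. by move=> f0 df; exact: (@derivableV R[i] R[i]^o f z 1 f0 df). Qed.

(** Serves to subtract a Taylor polynomial and, with [f = 0], to differentiate [1 - c z], [z^2] and
    [2 z]. *)
Lemma derive1_sub_quadratic f (a b c z : R[i]) : derivable f z 1 ->
  let g := fun y : R[i]^o => (f y - (a + b * y + c * y ^+ 2) : R[i]^o) in
  derivable g z 1 /\ derive1 g z = derive1 f z - b - 2 * c * z.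
Proof.
move=> df g; apply: expand_derivable => e e0.
have e2 : 0 < e / 2 by rewrite divr_gt0.
have [d d0 Hd] := derivable_expand df e2.
have K0 : 0 < 2 * (cabs c + 1) by rewrite mulr_gt0 // ltr_wpDl ?cabs_ge0.
exists (Num.min d (e / (2 * (cabs c + 1)))); first by rewrite lt_min d0 divr_gt0.
move=> y; rewrite lt_min => /andP[/Hd yd yc].
have -> : g y - g z - (derive1 f z - b - 2 * c * z) * (y - z) =
  (f y - f z - derive1 f z * (y - z)) - c * (y - z) * (y - z) by rewrite /g; ring.
apply: (le_trans (cabsB _ _)); apply: (le_trans (lerD yd (lexx _))).
rewrite !cabsM -mulrDl ler_wpM2r ?cabs_ge0 //.
rewrite ltr_pdivlMr // in yc.
have := cabs_ge0 (y - z); have := cabs_ge0 c; nra.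
Qed.

Lemma derivable_shift f (p z : R[i]) : derivable f (p + z) 1 ->
  let g := fun y : R[i]^o => (f (p + y) : R[i]^o) in
  derivable g z 1 /\ derive1 g z = derive1 f (p + z).
Proof.
move=> df g; apply: expand_derivable => e e0.
have [d d0 Hd] := derivable_expand df e0; exists d => // y yd.
have := Hd (p + y); have -> : p + y - (p + z) = y - z by ring.
exact.
Qed.
End ComplexDerivative.

(** * Circles and the shrinking factor *)

Section Circle.
Variable R : realType.
Implicit Types (rho : R).

Definition circ rho (t : R) : R[i] := ((rho * cos t) +i* (rho * sin t))%C.

Lemma is_derive_scale (k : R) (g : R -> R) (x dg : R) :
  is_derive x 1 g dg -> is_derive x 1 (fun y => k * g y) (k * dg).
Proof. by move=> ?; exact: (@is_deriveZ _ _ R^o). Qed.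

Lemma cder_circ rho : cder (circ rho) (fun t => 'i%C * circ rho t).
Proof.
move=> x; rewrite ReM ImM /= !mul0r !mul1r sub0r add0r -mulrN.
by split; apply: is_derive_scale.
Qed.

Lemma ccont_circ rho : ccont (circ rho).
Proof.
apply: ccont_ReIm => x; apply: cvgM; try exact: cvg_cst.
  exact: continuous_cos.
exact: continuous_sin.
Qed.

Lemma cabs_circ rho t : 0 < rho -> cabs (circ rho t) = rho.
Proof.
move=> r0; rewrite /cabs /= !exprMn -mulrDr cos2Dsin2 mulr1 sqrtr_sqr.
exact: gtr0_norm.
Qed.

Lemma circ_neq0 rho t : 0 < rho -> circ rho t != 0.
Proof. by move=> r0; rewrite -cabs_gt0 cabs_circ. Qed.

Lemma circ2pi rho : circ rho (2 * pi) = circ rho 0.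
Proof.
by rewrite /circ mulr_natl cos2pi sin2pi cos0 sin0.
Qed.

Lemma circJ rho t : (circ rho t)^*%C * circ rho t = ((rho ^+ 2)%:C)%C.
Proof.
apply: complex_eqP; rewrite ?ReM ?ImM /=; last by ring.
by rewrite -[RHS]mulr1 -(cos2Dsin2 t); ring.
Qed.

Lemma cder_real (P p : R -> R) : (forall x : R, is_derive x 1 P (p x)) ->
  cder (fun x => (P x)%:C%C) (fun x => (p x)%:C%C).
Proof. by move=> HP x; split => /=; [exact: HP|exact: is_derive_cst]. Qed.

(* Takes values in [(0, 1]], equals [1] at [0] and tends to [0]: defined on the whole
   line, it spares every one-sided or boundary condition in the homotopy below. *)
Definition shrink (x : R) : R := expR (- (x * x)).

Lemma is_derive_shrink (x : R) : is_derive x 1 shrink (shrink x * (- 2 * x)).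
Proof.
apply: (@is_derive1_comp _ expR (fun x : R => - (x * x))).
have -> : - 2 * x = - (x * 1 + x * 1) by ring.
by apply: is_deriveN; exact: (@is_deriveM R R^o id id).
Qed.

Lemma shrink_gt0 x : 0 < shrink x.
Proof. exact: expR_gt0. Qed.

Lemma norm_shrink x : `|shrink x| = shrink x.
Proof. by rewrite gtr0_norm // shrink_gt0. Qed.

Lemma shrink_le1 x : shrink x <= 1.
Proof. by rewrite -expR0 ler_expR oppr_le0 -expr2 sqr_ge0. Qed.

Lemma shrink0 : shrink 0 = 1.
Proof. by rewrite /shrink mulr0 oppr0 expR0. Qed.

(** By [1 + y <= exp y] at [y = x^2]. Both the Lipschitz constant 1 and an explicit rate of decay
    follow from it. *)
Lemma shrink_mul x : shrink x * (1 + x * x) <= 1.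
Proof.
rewrite /shrink expRN mulrC ler_pdivrMr ?expR_gt0 // mul1r.
exact: expR_ge1Dx.
Qed.

Lemma shrink_lip (x y : R) : `|shrink y - shrink x| <= `|y - x|.
Proof.
have H (a b : R) : a <= b -> `|shrink b - shrink a| <= 1 * (b - a).
  move=> ab; apply: (MVT_le ab is_derive_shrink) => t _.
  rewrite normrM norm_shrink normrM normrN normr_nat.
  apply: le_trans _ (shrink_mul t); rewrite ler_pM2l ?shrink_gt0 //.
  rewrite -[t * t]expr2 -(real_normK (num_real t)).
  by have := sqr_ge0 (`|t| - 1); rewrite sqrrB1; lra.
have [xy|/ltW yx] := leP x y.
  by rewrite [leRHS]ger0_norm ?subr_ge0 // -[leRHS]mul1r H.
by rewrite distrC [leRHS]distrC [leRHS]ger0_norm ?subr_ge0 // -[leRHS]mul1r H.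
Qed.

Lemma circ_lip rho (x y : R) : 0 < rho ->
  cabs (circ rho y - circ rho x) <= 2 * rho * `|y - x|.
Proof.
move=> r0.
have H (a b : R) : a <= b -> cabs (circ rho b - circ rho a) <= 2 * rho * (b - a).
  move=> ab; apply: (cder_le ab (cder_circ rho)) => t _.
  by rewrite cabsM cabs_i mul1r cabs_circ.
have [xy|/ltW yx] := leP x y; first by rewrite ger0_norm ?subr_ge0 // H.
by rewrite cabs_distC distrC ger0_norm ?subr_ge0 // H.
Qed.

End Circle.

(** * Deformation of a circle to a point *)

Section Goursat.
Variables (R : realType) (f : R[i]^o -> R[i]^o) (r rho : R) (w : R[i]).
Hypothesis df : forall z : R[i], cabs z < r -> derivable f z 1.
Hypotheses (rho0 : 0 < rho) (rhor : rho < r) (wrho : cabs w < rho).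

Let zeta := circ rho.
(* [A dt + B dx] is the pullback of [dz / (z - w)] by [zz]. *)
Let zz (x t : R) : R[i] := w + (shrink x)%:C%C * (zeta t - w).
Let A (t : R) : R[i] := 'i%C * zeta t / (zeta t - w).
Let B (x : R) : R[i] := ((- 2 * x)%:C)%C.
Let U (x t : R) : R[i] := f (zz x t).

Let cont_shrink : continuous (@shrink R).
Proof.
move=> x; apply: differentiable_continuous; apply/derivable1_diffP.
by apply: ex_derive; exact: is_derive_shrink.
Qed.

Let zetaw t : zeta t - w != 0.
Proof.
rewrite subr_eq0; apply: contraTneq wrho => <-.
by rewrite /zeta cabs_circ // ltxx.
Qed.

Let ccont_zetaw : ccont (fun t => zeta t - w).
Proof. by apply: ccontB; [exact: ccont_circ|exact: ccont_cst]. Qed.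

Let ccontA : ccont A.
Proof.
apply: ccontM; last exact: ccontV zetaw ccont_zetaw.
by apply: ccontM; [exact: ccont_cst|exact: ccont_circ].
Qed.

Let ccontB' : ccont B.
Proof.
apply: ccont_real => x; apply: cvgM; first exact: cvg_cst.
exact: cvg_id.
Qed.

Let ccont_zzt x : ccont (zz x).
Proof.
apply: ccontD; first exact: ccont_cst.
by apply: ccontM; [exact: ccont_cst|exact: ccont_zetaw].
Qed.

Let ccont_zzx t : ccont (zz ^~ t).
Proof.
apply: ccontD; first exact: ccont_cst.
by apply: ccontM; [exact: ccont_real cont_shrink|exact: ccont_cst].
Qed.

Let zz_lt x t : cabs (zz x t) < r.
Proof.
have -> : zz x t = ((1 - shrink x)%:C)%C * w + (shrink x)%:C%C * zeta t.
  by rewrite /zz rmorphB rmorph1; ring.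
apply: (le_lt_trans (cabsD _ _)); rewrite !cabsM !cabs_real /zeta cabs_circ //.
have s0 := shrink_gt0 x; have s1 := shrink_le1 x.
rewrite norm_shrink [`|1 - _|]ger0_norm ?subr_ge0 //.
have : 0 <= (1 - shrink x) * (rho - cabs w).
  by rewrite mulr_ge0 // subr_ge0 // ltW.
by move: rhor; lra.
Qed.

Let dU x t : derivable f (zz x t) 1. Proof. exact: df. Qed.

Let ccontUt x : ccont (U x).
Proof. by apply: ccont_comp => // t. Qed.
Let ccontUx t : ccont (U ^~ t).
Proof. by apply: (@ccont_comp _ f (zz ^~ t)) => // x. Qed.

(** Integral of the pullback of [f(z) dz / (z - w)] along the boundary of [[a, b] x [c, d]]. Since
    [zz x t - w] is a product of a function of [x] and one of [t], [A] depends on [t] alone and [B]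
    on [x] alone, so opposite sides share one integral. *)
Let J (a b c d : R) : R[i] :=
  cint (fun t => (U b t - U a t) * A t) c d -
  cint (fun x => (U x d - U x c) * B x) a b.

Let JU : forall a b : R, ccont (fun t => (U b t - U a t) * A t).
Proof. by move=> a b; apply: ccontM => //; apply: ccontB. Qed.
Let JV : forall c d : R, ccont (fun x => (U x d - U x c) * B x).
Proof. by move=> c d; apply: ccontM => //; apply: ccontB. Qed.

Let Jx m a b c d : J a b c d = J a m c d + J m b c d.
Proof.
rewrite /J (cint_chasles _ a b m) -[X in X + _ = _](_ :
  cint (fun t => (U m t - U a t) * A t + (U b t - U m t) * A t) c d = _).
  by rewrite (cintD _ _ (JU _ _) (JU _ _)); ring.
by congr cint; apply/funext => t; ring.
Qed.

Let Jy m a b c d : J a b c d = J a b c m + J a b m d.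
Proof.
rewrite /J (cint_chasles _ c d m) -[X in _ - X = _](_ :
  cint (fun x => (U x m - U x c) * B x + (U x d - U x m) * B x) a b = _).
  by rewrite (cintD _ _ (JV _ _) (JV _ _)); ring.
by congr cint; apply/funext => t; ring.
Qed.

Let zz_lip (x x0 t t0 : R) :
  cabs (zz x t - zz x0 t0) <= 2 * rho * (`|x - x0| + `|t - t0|).
Proof.
have -> : zz x t - zz x0 t0 = ((shrink x - shrink x0)%:C)%C * (zeta t - w)
  + (shrink x0)%:C%C * (zeta t - zeta t0) by rewrite /zz rmorphB; ring.
apply: (le_trans (cabsD _ _)); rewrite !cabsM !cabs_real mulrDr lerD //.
  rewrite mulrC ler_pM ?cabs_ge0 //; last exact: shrink_lip.
  apply: (le_trans (cabsB _ _)); rewrite /zeta cabs_circ //.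
  by move: wrho; lra.
apply: le_trans _ (circ_lip t0 t rho0).
by rewrite norm_shrink ler_piMl ?cabs_ge0 // shrink_le1.
Qed.

Let KA : R := rho / (rho - cabs w).
Let KA0 : 0 < KA. Proof. by rewrite divr_gt0 // subr_gt0. Qed.
Let A_le t : cabs (A t) <= KA.
Proof.
rewrite /A !cabsM cabsV cabs_i mul1r {1}/zeta cabs_circ // /KA.
rewrite ler_pM2l // lef_pV2 ?posrE ?subr_gt0 ?cabs_gt0 //.
by apply: le_trans _ (cabs_le_sub _ _); rewrite /zeta cabs_circ.
Qed.

(** The affine part of [f] at [zz x y] contributes nothing to [J]. The remainder [E] is small
    relative to the side lengths, and integrating it along the sides brings in a second factor of
    that order. *)
Let Jloc (x y e : R) : 0 < e -> exists2 dt : R, 0 < dt & forall a b c d : R,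
     a <= x <= b -> c <= y <= d -> b - a < dt -> d - c < dt ->
     cabs (J a b c d) <= e * ((b - a) + (d - c)) ^+ 2.
Proof.
move=> e0; set l : R[i] := derive1 f (zz x y).
pose KB : R := 2 * (`|x| + 1).
have KB0 : 0 < KB by rewrite mulr_gt0 // ltr_wpDl.
pose e1 : R := e / (8 * rho * (KA + KB)).
have K0 : 0 < 8 * rho * (KA + KB) by rewrite !mulr_gt0 // addr_gt0.
have e10 : 0 < e1 by rewrite divr_gt0.
have [dl dl0 Hdl] := derivable_expand (df (zz_lt x y)) e10.
have q0 : 0 < dl / (4 * rho + 1) by rewrite divr_gt0 // ltr_wpDl // mulr_ge0 // ltW.
(* Sides below 1 give [|B| <= KB] on the rectangle; sides below [dl / (4 rho + 1)] keep [zz] within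
   [dl] of [zz x y]. *)
exists (Num.min 1 (dl / (4 * rho + 1))); first by rewrite lt_min ltr01.
move=> a b c d /andP[ax xb] /andP[cy yd].
rewrite !lt_min => /andP[ba1 ba2] /andP[dc1 dc2].
pose E (s t : R) : R[i] := U s t - U x y - l * (zz s t - zz x y).
set S := (b - a) + (d - c).
have S0 : 0 <= S by rewrite /S; lra.
have E_le (s t : R) : a <= s <= b -> c <= t <= d -> cabs (E s t) <= e1 * (2 * rho * S).
  move=> /andP[as_ sb] /andP[ct td].
  have sx : `|s - x| <= b - a by rewrite ler_norml; apply/andP; split; lra.
  have ty : `|t - y| <= d - c by rewrite ler_norml; apply/andP; split; lra.
  have zS : cabs (zz s t - zz x y) <= 2 * rho * S.
    apply: (le_trans (zz_lip s x t y)); rewrite ler_wpM2l ?lerD //.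
    by rewrite mulr_ge0 // ltW.
  apply: (le_trans (Hdl _ _)); last by rewrite ler_pM2l.
  apply: (le_lt_trans zS).
  have := mulr_gt0 rho0 dl0; move: ba2 dc2; rewrite /S.
  set q := dl / _ => ba2 dc2 _.
  have -> : dl = q * (4 * rho + 1).
    by rewrite /q divfK // gt_eqF // ltr_wpDl // mulr_ge0 // ltW.
  by have := mulr_gt0 rho0 q0; rewrite -/q; nra.
have ccEt s : ccont (E s).
  apply: ccontB; first by apply: ccontB => //; exact: ccont_cst.
  by apply: ccontM; [exact: ccont_cst|apply: ccontB => //; exact: ccont_cst].
have ccEx t : ccont (E ^~ t).
  apply: ccontB; first by apply: ccontB => //; exact: ccont_cst.
  by apply: ccontM; [exact: ccont_cst|apply: ccontB => //; exact: ccont_cst].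
have ccEA : ccont (fun t => (E b t - E a t) * A t).
  by apply: ccontM => //; apply: ccontB.
have ccEB : ccont (fun s => (E s d - E s c) * B s).
  by apply: ccontM => //; apply: ccontB.
(* Constants vanish in the differences, and the linear part yields [l (shrink b - shrink a) (zeta d
   - zeta c)] in both integrals, because ['i * zeta] and [shrink s * (- 2 * s)] have the primitives
   [zeta] and [shrink]. *)
have JE : J a b c d = cint (fun t => (E b t - E a t) * A t) c d -
    cint (fun s => (E s d - E s c) * B s) a b.
  rewrite /J.
  have -> : (fun t => (U b t - U a t) * A t) = (fun t =>
     (l * ((shrink b - shrink a)%:C)%C) * ('i%C * zeta t) + (E b t - E a t) * A t).
    apply/funext => t; rewrite /A /E /zz rmorphB /=.
    by field; exact: zetaw.
  have -> : (fun s => (U s d - U s c) * B s) = (fun s =>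
     (l * (zeta d - zeta c)) * (shrink s * (- 2 * s))%:C%C + (E s d - E s c) * B s).
    by apply/funext => s; rewrite /B /E /zz rmorphM /=; ring.
  have cc1 : ccont (fun t => 'i%C * zeta t).
    by apply: ccontM; [exact: ccont_cst|exact: ccont_circ].
  have cc2 : ccont (fun s : R => (shrink s * (- 2 * s))%:C%C).
    apply: (@eq_ccont _ (fun s => (shrink s)%:C%C * B s)) => [s|].
      by rewrite rmorphM.
    by apply: ccontM => //; exact: ccont_real.
  have ccl (u : R -> R[i]) (k : R[i]) : ccont u -> ccont (fun s => k * u s).
    by move=> cu; apply: ccontM => //; exact: ccont_cst.
  rewrite !cintD //; try exact: ccl.
  rewrite (cintZ _ _ _ cc1) (cintZ _ _ _ cc2) (cint_FTC _ _ (cder_circ rho)).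
  by rewrite (cint_FTC _ _ (cder_real (@is_derive_shrink R))) rmorphB /= -/zeta; ring.
rewrite JE; apply: (le_trans (cabsB _ _)).
pose M := e1 * (2 * rho * S).
have M0 : 0 <= M.
  apply: mulr_ge0; first exact: ltW.
  by apply: mulr_ge0 => //; apply: mulr_ge0 => //; exact: ltW.
have I1 : cabs (cint (fun t => (E b t - E a t) * A t) c d) <=
    2 * ((M + M) * KA) * (d - c).
  apply: cint_le => //; first lra.
  move=> t tcd; rewrite cabsM ler_pM ?cabs_ge0 //.
  apply: (le_trans (cabsB _ _)); rewrite lerD // E_le //; apply/andP; split; lra.
have I2 : cabs (cint (fun s => (E s d - E s c) * B s) a b) <=
    2 * ((M + M) * KB) * (b - a).
  apply: cint_le => //; first lra.
  move=> s sab; rewrite cabsM ler_pM ?cabs_ge0 //.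
    apply: (le_trans (cabsB _ _)); rewrite lerD // E_le //; apply/andP; split; lra.
  rewrite cabs_real normrM normrN normr_nat ler_pM2l //.
  have -> : s = x + (s - x) by ring.
  apply: (le_trans (ler_normD _ _)); rewrite lerD2l ler_norml.
  by move/andP: sab => [? ?]; apply/andP; split; lra.
apply: (le_trans (lerD I1 I2)).
have -> : e * S ^+ 2 = 4 * M * (KA + KB) * S.
  by rewrite /M /e1; field; rewrite gt_eqF ?addr_gt0 // gt_eqF.
rewrite /S; have : 0 <= M * KA * (b - a).
  by rewrite mulr_ge0 ?subr_ge0 ?(le_trans ax) // mulr_ge0 // ltW.
have : 0 <= M * KB * (d - c).
  by rewrite mulr_ge0 ?subr_ge0 ?(le_trans cy) // mulr_ge0 // ltW.
by nra.
Qed.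

(** The sides [t = 0] and [t = 2 pi] have the same image, so their contributions cancel and only the
    closed curves at [x = 0] and [x = X] remain. *)
Let A_const (X : R) : 0 <= X -> cint (fun t => (U X t - U 0 t) * A t) 0 (2 * pi) = 0.
Proof.
move=> X0; have := additive_rectangle_eq0 Jx Jy Jloc X0 (mulr_ge0 (ler0n R 2) (pi_ge0 R)).
rewrite /J => <-; rewrite [X in _ = _ - X](_ : _ = 0) ?subr0 //.
have -> : (fun x => (U x (2 * pi) - U x 0) * B x) = (fun=> 0).
  by apply/funext => x; rewrite /U /zz /zeta circ2pi subrr mul0r.
rewrite (@cint_FTC _ _ (fun=> 0)) ?subrr // => x; split; exact: is_derive_cst.
Qed.

(** The integral of [(f - f w) dz / (z - w)] is the same on all the curves of the family. The kernel
    does not change with [x], while [f - f w] tends to 0 as the curve shrinks to [w]. The integral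
    of the kernel itself is left unevaluated here. *)
Lemma cauchy_formula_unnormalized :
  cint (fun t => f (zeta t) * (zeta t / (zeta t - w))) 0 (2 * pi) =
  f w * cint (fun t => zeta t / (zeta t - w)) 0 (2 * pi).
Proof.
have cq : ccont (fun t => zeta t / (zeta t - w)).
  by apply: ccontM; [exact: ccont_circ|exact: ccontV zetaw ccont_zetaw].
have U0 t : U 0 t = f (zeta t) by rewrite /U /zz shrink0 mul1r addrC subrK.
have cf : ccont (fun t => f (zeta t)).
  by have := ccontUt 0; congr (ccont _); apply/funext => t; rewrite U0.
rewrite -cintZ //; apply/eqP; rewrite -subr_eq0 -cintB; last first.
- by apply: ccontM => //; exact: ccont_cst.
- exact: ccontM.
have cfw x : ccont (fun t => (U x t - f w) * (zeta t / (zeta t - w))).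
  by apply: ccontM => //; apply: ccontB => //; exact: ccont_cst.
have -> : (fun t => f (zeta t) * (zeta t / (zeta t - w)) -
    f w * (zeta t / (zeta t - w))) =
    (fun t => (U 0 t - f w) * (zeta t / (zeta t - w))).
  by apply/funext => t; rewrite U0; ring.
have step X : 0 <= X -> cint (fun t => (U 0 t - f w) * (zeta t / (zeta t - w))) 0 (2 * pi) =
   cint (fun t => (U X t - f w) * (zeta t / (zeta t - w))) 0 (2 * pi).
  move=> /A_const /esym/eqP H.
  have i0 : ('i%C : R[i]) != 0 by rewrite -cabs_gt0 cabs_i.
  apply/esym/eqP; rewrite -subr_eq0 -cintB // -(inj_eq (mulfI i0)) mulr0 -cintZ.
    rewrite eq_sym; move: H; congr (_ == cint _ _ _).
    by apply/funext => t; rewrite /A; ring.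
  exact: ccontB.
rewrite -cabs_eq0 eq_le cabs_ge0 andbT; apply/ler_addgt0Pr => e e0; rewrite add0r.
have wr : cabs w < r by apply: lt_trans wrho _.
have [d d0 Hd] := derivable_expand (df wr) ltr01.
set l := cabs (derive1 f w).
have l0 : 0 <= l by exact: cabs_ge0.
(* The first term matches the final estimate, [2 * rho] ensures [q * (2 * rho) < d], and 1 makes [K]
   positive and that inequality strict. *)
pose K : R := (1 + l) * (2 * rho) * KA * (4 * pi) + 2 * rho + 1.
have K1 : 0 <= (1 + l) * (2 * rho) * KA * (4 * pi).
  have a1 : 0 <= 1 + l by rewrite addr_ge0.
  have a2 : 0 <= 2 * rho by rewrite mulr_ge0 // ltW.
  have a3 : 0 <= 4 * pi :> R by rewrite mulr_ge0 // pi_ge0.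
  exact: (mulr_ge0 (mulr_ge0 (mulr_ge0 a1 a2) (ltW KA0)) a3).
have Kp : 0 < K.
  by rewrite ltr_wpDl // addr_ge0 // mulr_ge0 // ltW.
pose q := Num.min d e / K.
have q0 : 0 < q by rewrite divr_gt0 // lt_min d0.
(* This choice gives [1 <= q * (1 + X * X)], so [shrink_mul] yields [shrink X <= q]. *)
pose X := q^-1 + 1; have X0 : 0 <= X by rewrite addr_ge0 // invr_ge0 ltW.
rewrite (step X X0).
have sX : shrink X <= q.
  have := shrink_mul X; have := shrink_gt0 X => s0 s1.
  have qX : 1 <= q * (1 + X * X).
    have qi : q * q^-1 = 1 by rewrite divff // gt_eqF.
    have -> : q * (1 + X * X) = q + (q * q^-1) * q^-1 + 2 * (q * q^-1) + q.
      by rewrite /X; ring.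
    have q1 : 0 < q^-1 by rewrite invr_gt0.
    by rewrite qi; move: q0 q1; lra.
  have X1 : 0 < 1 + X * X by have := sqr_ge0 X; rewrite expr2; lra.
  by rewrite -(ler_pM2r X1); lra.
have qd : q * (2 * rho) < d.
  have qK : q * K = Num.min d e by rewrite /q divfK // gt_eqF.
  have : q * K <= d by rewrite qK ge_min lexx.
  rewrite /K.
  by move: (mulr_ge0 (ltW q0) K1); move: (_ * (4 * pi)) => k; lra.
have UX t : cabs (U X t - f w) <= (1 + l) * (2 * rho * q).
  have zw : cabs (zz X t - w) <= 2 * rho * q.
    have -> : zz X t - w = (shrink X)%:C%C * (zeta t - w) by rewrite /zz; ring.
    rewrite cabsM cabs_real norm_shrink mulrC ler_pM ?cabs_ge0 ?(ltW (shrink_gt0 X)) //.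
    apply: (le_trans (cabsB _ _)); rewrite /zeta cabs_circ //.
    by move: wrho; lra.
  have zd : cabs (zz X t - w) < d by apply: le_lt_trans zw _; rewrite mulrC.
  have := Hd _ zd; rewrite mul1r => H1.
  have -> : U X t - f w = (f (zz X t) - f w - derive1 f w * (zz X t - w)) +
     derive1 f w * (zz X t - w) by rewrite /U; ring.
  apply: (le_trans (cabsD _ _)); rewrite cabsM -/l.
  apply: le_trans (_ : (1 + l) * cabs (zz X t - w) <= _); first lra.
  by rewrite ler_wpM2l // addr_ge0.
apply: (le_trans (@cint_le _ _ ((1 + l) * (2 * rho * q) * KA) 0 (2 * pi) _ _ _)) => //.
- by rewrite mulr_ge0 ?pi_ge0.
- move=> t _; rewrite cabsM ler_pM ?cabs_ge0 //.
  by have := A_le t; rewrite /A -mulrA cabsM cabs_i mul1r.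
have qK : q * K = Num.min d e by rewrite /q divfK // gt_eqF.
have : q * K <= e by rewrite qK ge_min lexx orbT.
apply: le_trans; rewrite /K.
have -> : 2 * ((1 + l) * (2 * rho * q) * KA) * (2 * pi - 0) =
  q * ((1 + l) * (2 * rho) * KA * (4 * pi)) by ring.
by rewrite ler_pM2l // -addrA lerDl addr_ge0 // mulr_ge0 // ltW.
Qed.

End Goursat.

(** * Cauchy's formula and Taylor coefficients *)

Section CircleMean.
Variable R : realType.
Implicit Types (r rho : R) (u v : R -> R[i]) (f : R[i]^o -> R[i]^o) (k : R[i]).

Definition cmean u : R[i] := cint u 0 (2 * pi) / ((2 * pi)%:C)%C.

Lemma conjcM (a b : R[i]) : (a * b)^*%C = a^*%C * b^*%C.
Proof. exact: rmorphM. Qed.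

Lemma conjcB (a b : R[i]) : (a - b)^*%C = a^*%C - b^*%C.
Proof. exact: rmorphB. Qed.

Let pi2_gt0 : 0 < 2 * pi :> R. Proof. by rewrite mulr_gt0 // pi_gt0. Qed.
Let pi2_neq0 : ((2 * pi : R)%:C)%C != 0 :> R[i].
Proof. by rewrite -cabs_gt0 cabs_real normr_gt0 gt_eqF. Qed.

Lemma cmeanD u v : ccont u -> ccont v ->
  cmean (fun t => u t + v t) = cmean u + cmean v.
Proof. by move=> cu cv; rewrite /cmean cintD // mulrDl. Qed.

Lemma cmeanB u v : ccont u -> ccont v ->
  cmean (fun t => u t - v t) = cmean u - cmean v.
Proof. by move=> cu cv; rewrite /cmean cintB // mulrBl. Qed.

Lemma cmeanZ k u : ccont u -> cmean (fun t => k * u t) = k * cmean u.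
Proof. by move=> cu; rewrite /cmean cintZ // mulrA. Qed.

Lemma cmeanJ u : ccont u -> cmean (fun t => (u t)^*%C) = (cmean u)^*%C.
Proof.
move=> cu; rewrite /cmean cintJ // conjcM; congr (_ * _).
by rewrite conjc_inv conjc_real.
Qed.

Lemma cmean_cst k : cmean (fun=> k) = k.
Proof.
have H : cder (fun t : R => k * (t%:C)%C) (fun=> k * (1%:C)%C).
  by apply: cderZ; apply: cder_real.
rewrite /cmean; have -> : (fun=> k) = (fun=> k * (1%:C)%C) :> (R -> R[i]).
  by apply/funext => t; rewrite mulr1.
by rewrite (cint_FTC _ _ H) mulr0 subr0 mulfK.
Qed.

Lemma cmean_le u (K : R) : ccont u -> (forall t, cabs (u t) <= K) ->
  cabs (cmean u) <= 2 * K.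
Proof.
move=> cu uK; rewrite /cmean cabsM cabsV cabs_real gtr0_norm //.
rewrite ler_pdivrMr //.
by have := cint_le (ltW pi2_gt0) cu (fun t _ => uK t); rewrite subr0.
Qed.

Lemma Re_cmean_ge0 u : ccont u -> (forall t, 0 <= complex.Re (u t)) ->
  0 <= complex.Re (cmean u).
Proof.
move=> cu u0; rewrite /cmean -fmorphV ReM /= mulr0 subr0 mulr_ge0 //.
  exact: Re_cint_ge0 (ltW pi2_gt0) cu u0.
by rewrite invr_ge0 ltW.
Qed.

Definition holo (r : R) f := forall z : R[i], cabs z < r -> derivable f z 1.

Lemma ccont_holo r rho f : holo r f -> 0 < rho -> rho < r ->
  ccont (fun t => f (circ rho t)).
Proof.
move=> df rho0 rhor; apply: ccont_comp; last exact: ccont_circ.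
by move=> t; apply: df; rewrite cabs_circ.
Qed.

(** At [w = 0] the kernel is constantly 1, so the unnormalized formula is enough. The mean of the
    kernel for general [w] is deduced from this case. *)
Lemma cmean_holo r rho f : holo r f -> 0 < rho -> rho < r ->
  cmean (fun t => f (circ rho t)) = f 0.
Proof.
move=> df rho0 rhor; have w0 : cabs (0 : R[i]) < rho by rewrite cabs0.
have := cauchy_formula_unnormalized df rho0 rhor w0.
have q1 t : circ rho t / (circ rho t - 0) = 1 by rewrite subr0 divff // circ_neq0.
under eq_fun do rewrite q1 mulr1.
under [X in _ * cint X _ _]eq_fun do rewrite q1.
have := cmean_cst 1; rewrite /cmean => H -> .
by rewrite -mulrA H mulr1.
Qed.

Lemma holo_powM r f n : holo r f -> holo r (fun y : R[i]^o => y ^+ n * f y : R[i]^o).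
Proof.
move=> df z zr.
exact: (@derivable_mulc _ (fun y : R[i]^o => y ^+ n : R[i]^o) f z
  (@derivable_powc R z n) (df z zr)).
Qed.

Lemma cmean_holo_pow r rho f n : holo r f -> 0 < rho -> rho < r ->
  cmean (fun t => f (circ rho t) * circ rho t ^+ n.+1) = 0.
Proof.
move=> df rho0 rhor; have := cmean_holo (@holo_powM _ _ n.+1 df) rho0 rhor.
rewrite expr0n /= mul0r => <-.
by congr cmean; apply/funext => t; rewrite mulrC.
Qed.

Lemma circ_subr_neq0 rho (w : R[i]) t : 0 < rho -> cabs w < rho -> circ rho t - w != 0.
Proof.
move=> rho0 wr; rewrite subr_eq0; apply: contraTneq wr => <-.
by rewrite cabs_circ // ltxx.
Qed.

Lemma ccont_cauchy_kernel rho (w : R[i]) : 0 < rho -> cabs w < rho ->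
  ccont (fun t => circ rho t / (circ rho t - w)).
Proof.
move=> rho0 wr; apply: ccontM; first exact: ccont_circ.
apply: ccontV => [t|]; first exact: circ_subr_neq0.
by apply: ccontB; [exact: ccont_circ|exact: ccont_cst].
Qed.

(* The conjugate of the kernel is [1 / (1 - conj w * z / rho^2)] on the circle,
   which is holomorphic on a larger disk. *)
Lemma cmean_cauchy_kernel rho (w : R[i]) : 0 < rho -> cabs w < rho ->
  cmean (fun t => circ rho t / (circ rho t - w)) = 1.
Proof.
move=> rho0 wr; pose c : R[i] := w^*%C / ((rho ^+ 2)%:C)%C.
(* Harmonic mean of [rho] and [rho^2 / |w|], the modulus of the pole; the formula keeps its meaning
   at [w = 0]. *)
pose r : R := 2 * rho ^+ 2 / (rho + cabs w).
have w0 := cabs_ge0 w.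
have rw : 0 < rho + cabs w by rewrite ltr_wpDr.
have rho2 : 0 < rho ^+ 2 by rewrite exprn_gt0.
have rhor : rho < r.
  by rewrite /r ltr_pdivlMr //; have := mulr_gt0 rho0 rho0; rewrite expr2; nra.
have cr : cabs c * r <= 1.
  rewrite /c cabsM cabsV cabs_real gtr0_norm // cabsJ /r.
  have -> : cabs w / rho ^+ 2 * (2 * rho ^+ 2 / (rho + cabs w)) =
    (2 * cabs w) / (rho + cabs w) by field; rewrite !gt_eqF.
  by rewrite ler_pdivrMr //; lra.
have nz (z : R[i]) : cabs z < r -> 1 - c * z != 0.
  move=> zr; rewrite subr_eq0; apply/eqP => E.
  have : cabs (c * z) < 1.
    have [c0|c0] := eqVneq c 0; first by rewrite c0 mul0r cabs0.
    by rewrite cabsM (lt_le_trans _ cr) // ltr_pM2l // cabs_gt0.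
  by rewrite -E cabs1 ltxx.
have dg : holo r (fun y : R[i]^o => (1 - c * y)^-1 : R[i]^o).
  move=> z zr; apply: derivable_invc; first exact: nz.
  have d0 : derivable (fun=> 0 : R[i]^o) (z : R[i]^o) 1 by exact: derivable_cst.
  have [+ _] := derive1_sub_quadratic (- 1) c 0 d0.
  have -> : (fun y : R[i]^o => 1 - c * y : R[i]^o) =
    (fun y : R[i]^o => 0 - (-1 + c * y + 0 * y ^+ 2) : R[i]^o).
    by apply/funext => y; ring.
  exact.
have := cmean_holo dg rho0 rhor; rewrite mulr0 subr0 invr1 => /(congr1 conjc).
rewrite conjc1 -cmeanJ; last exact: ccont_holo dg rho0 rhor.
move=> <-; congr cmean; apply/funext => t.
have zJ := circJ rho t; have z0 := circ_neq0 t rho0.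
have zw := circ_subr_neq0 t rho0 wr.
rewrite conjc_inv conjcB conjc1 /c !conjcM conjc_inv conjc_real conjcK.
have -> : ((rho ^+ 2)%:C)%C = (circ rho t)^*%C * circ rho t by [].
have zc0 : (circ rho t)^*%C != 0 by rewrite conjc_eq0.
by field; rewrite z0 zc0 zw.
Qed.

Lemma cauchy_formula r rho f (w : R[i]) : holo r f -> 0 < rho -> rho < r ->
  cabs w < rho ->
  cmean (fun t => f (circ rho t) * (circ rho t / (circ rho t - w))) = f w.
Proof.
move=> df rho0 rhor wr; rewrite /cmean (cauchy_formula_unnormalized df) //.
have := cmean_cauchy_kernel rho0 wr; rewrite /cmean -mulrA => ->.
by rewrite mulr1.
Qed.

Definition tcoef rho f (k : nat) : R[i] :=
  cmean (fun t => f (circ rho t) * (circ rho t)^-1 ^+ k).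

Lemma ccont_tcoef r rho f (k : nat) : holo r f -> 0 < rho -> rho < r ->
  ccont (fun t => f (circ rho t) * (circ rho t)^-1 ^+ k).
Proof.
move=> df rho0 rhor; apply: ccontM; first exact: ccont_holo df rho0 rhor.
by apply: ccontX; apply: ccontV (ccont_circ rho) => t; exact: circ_neq0.
Qed.

Lemma tcoef_le r rho f n (M : R) : holo r f -> 0 < rho -> rho < r ->
  (forall t, cabs (f (circ rho t)) <= M) -> cabs (tcoef rho f n) <= 2 * (M / rho ^+ n).
Proof.
move=> df rho0 rhor fM; apply: cmean_le; first exact: ccont_tcoef df rho0 rhor.
move=> t; rewrite cabsM cabsX cabsV cabs_circ // exprVn ler_wpM2r //.
by rewrite invr_ge0 exprn_ge0 // ltW.
Qed.

Lemma tcoef0 r rho f : holo r f -> 0 < rho -> rho < r -> tcoef rho f 0 = f 0.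
Proof.
move=> df rho0 rhor; rewrite -(cmean_holo df rho0 rhor).
by congr cmean; apply/funext => t; rewrite expr0 mulr1.
Qed.

(** Cauchy's formula with the finite geometric sum [z / (z - w) = 1 + w/z + (w/z)^2 + (w/z)^3 z / (z
    - w)]. The constant 4 is the 2 of [cmean_le] times the bound 2 for [|z / (z - w)|], valid as
    [|w| <= rho / 2]. *)
Lemma taylor2 r rho f (M : R) (w : R[i]) : holo r f -> 0 < rho -> rho < r ->
  (forall t, cabs (f (circ rho t)) <= M) -> cabs w <= rho / 2 ->
  cabs (f w - (tcoef rho f 0 + tcoef rho f 1 * w + tcoef rho f 2 * w ^+ 2)) <=
  4 * M / rho ^+ 3 * cabs w ^+ 3.
Proof.
move=> df rho0 rhor fM w2.
have wr : cabs w < rho by move: rho0 w2; lra.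
have M0 : 0 <= M by apply: le_trans (fM 0); exact: cabs_ge0.
pose h t : R[i] := f (circ rho t) * (circ rho t)^-1 ^+ 3 *
  (circ rho t / (circ rho t - w)).
have ch : ccont h.
  by apply: ccontM; [exact: ccont_tcoef df rho0 rhor|exact: ccont_cauchy_kernel].
have ct n := ccont_tcoef n df rho0 rhor.
have cZ k u : ccont u -> ccont (fun t => k * u t).
  by move=> cu; apply: ccontM => //; exact: ccont_cst.
have E : f w = tcoef rho f 0 + w * tcoef rho f 1 + w ^+ 2 * tcoef rho f 2 +
    w ^+ 3 * cmean h.
  rewrite -(cauchy_formula df rho0 rhor wr) -!cmeanZ //.
  rewrite -cmeanD //; last exact: cZ.
  rewrite -cmeanD //; [|by apply: ccontD => //; exact: cZ|exact: cZ].
  rewrite -cmeanD //; [|by apply: ccontD; [apply: ccontD => //|]; exact: cZ|exact: cZ].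
  congr cmean; apply/funext => t; rewrite /h.
  have z0 := circ_neq0 t rho0; have zw := circ_subr_neq0 t rho0 wr.
  by field; rewrite z0 zw.
have -> : f w - (tcoef rho f 0 + tcoef rho f 1 * w + tcoef rho f 2 * w ^+ 2) =
  w ^+ 3 * cmean h by rewrite E; ring.
rewrite cabsM cabsX mulrC ler_wpM2r ?exprn_ge0 ?cabs_ge0 //.
have -> : 4 * M / rho ^+ 3 = 2 * (M * (rho^-1 ^+ 3 * (rho / (rho / 2)))).
  by field; rewrite gt_eqF.
apply: cmean_le => // t; rewrite /h -mulrA cabsM ler_pM ?cabs_ge0 //.
rewrite cabsM cabsX cabsV cabs_circ // ler_pM2l ?exprn_gt0 ?invr_gt0 //.
rewrite cabsM cabsV cabs_circ // ler_pM2l //.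
rewrite lef_pV2 ?posrE ?divr_gt0 // ?cabs_gt0 ?circ_subr_neq0 //.
apply: le_trans _ (cabs_le_sub _ _); rewrite cabs_circ //.
by move: w2; lra.
Qed.

Lemma derive1_tcoef r rho f : holo r f -> 0 < rho -> rho < r ->
  (exists M : R, forall t, cabs (f (circ rho t)) <= M) ->
  derive1 f 0 = tcoef rho f 1.
Proof.
move=> df rho0 rhor [M fM]; apply: (expand_derivable _).2 => e e0.
have M0 : 0 <= M by apply: le_trans (fM 0); exact: cabs_ge0.
set c := tcoef rho f; pose K : R := 4 * M / rho ^+ 3 + cabs (c 2) + 1.
have r3 : 0 < rho ^+ 3 by rewrite exprn_gt0.
have M3 : 0 <= 4 * M / rho ^+ 3 by rewrite divr_ge0 ?(ltW r3) // mulr_ge0.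
have c20 := cabs_ge0 (c 2).
have K0 : 0 < K by rewrite /K; move: M3 c20; lra.
exists (Num.min (Num.min 1 (rho / 2)) (e / K)).
  by rewrite !lt_min ltr01 !divr_gt0.
move=> w; rewrite !subr0 !lt_min => /andP[/andP[w1 w2] we].
have := taylor2 df rho0 rhor fM (ltW w2); rewrite -/c.
rewrite {1}/c (tcoef0 df) // => T.
have -> : f w - f 0 - c 1%N * w =
  (f w - (f 0 + c 1%N * w + c 2 * w ^+ 2)) + c 2 * w ^+ 2 by ring.
apply: (le_trans (cabsD _ _)); apply: (le_trans (lerD T (lexx _))).
rewrite cabsM cabsX; have w0 := cabs_ge0 w.
apply: le_trans (_ : K * cabs w * cabs w <= _); last first.
  by rewrite ler_wpM2r // mulrC -ler_pdivlMr // ltW.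
rewrite /K; move: (4 * M / _) M3 => m m0.
have ww : 0 <= cabs w ^+ 2 by rewrite exprn_ge0.
have www : cabs w ^+ 3 <= cabs w ^+ 2 by rewrite exprS ler_piMl // ltW.
by have := ler_wpM2l m0 www; rewrite -mulrA -expr2; lra.
Qed.

End CircleMean.

(** * Derivatives at the centre and the Toeplitz bound *)

Section CoefficientBound.
Variable R : realType.
Implicit Types (r rho : R) (f : R[i]^o -> R[i]^o).

Lemma cauchy_estimate r rho (M : R) f (p : R[i]) : 0 < rho -> rho < r ->
  (forall z : R[i], cabs (z - p) < r -> derivable f z 1) ->
  (forall z : R[i], cabs (z - p) = rho -> cabs (f z) <= M) ->
  cabs (derive1 f p) <= 2 * (M / rho).
Proof.
move=> rho0 rhor df fM; pose g : R[i]^o -> R[i]^o := fun y => f (p + y).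
have dg : holo r g.
  move=> z zr; apply: (derivable_shift _).1; apply: df.
  by rewrite addrC addKr.
have gM t : cabs (g (circ rho t)) <= M.
  by apply: fM; rewrite addrC addKr cabs_circ.
have d0 : derivable f (p + 0) 1.
  by apply: df; rewrite addr0 subrr cabs0 (lt_trans rho0).
have <- : derive1 g 0 = derive1 f p by rewrite (derivable_shift d0).2 addr0.
rewrite (derive1_tcoef dg rho0 rhor); last by exists M.
by have := tcoef_le 1 dg rho0 rhor gM; rewrite expr1.
Qed.

(* The Taylor remainder is [O(w^3)], so Cauchy's estimate on the circle of radius
   [|w| / 2] around [w] bounds its derivative by [O(w^2)]. *)
Lemma derive2_tcoef r rho f : holo r f -> 0 < rho -> rho < r ->
  (exists M : R, forall t, cabs (f (circ rho t)) <= M) ->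
  derive1 (fun z : R[i]^o => derive1 f z : R[i]^o) 0 = 2 * tcoef rho f 2.
Proof.
move=> df rho0 rhor [M fM]; apply: (expand_derivable _).2 => e e0.
have f'0 : derive1 f 0 = tcoef rho f 1.
  by apply: (derive1_tcoef df rho0 rhor); exists M.
have M0 : 0 <= M by apply: le_trans (fM 0); exact: cabs_ge0.
pose C : R := 4 * M / rho ^+ 3.
have C0 : 0 <= C.
  exact: (divr_ge0 (mulr_ge0 (ler0n R 4) M0) (exprn_ge0 3 (ltW rho0))).
(* 14 exceeds [27/2 = 4 (3/2)^3]: on the circle around [w] one has [|z| <= 3/2 |w|], and Cauchy's
   estimate multiplies by [4 / |w|]. The radius [rho / 3] below keeps [|z| <= rho / 2], as [taylor2]
   demands. *)
have K0 : 0 < 14 * C + 1 by rewrite ltr_wpDl // mulr_ge0.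
exists (Num.min (rho / 3) (e / (14 * C + 1))).
  by rewrite lt_min !divr_gt0.
move=> w; rewrite subr0 lt_min => /andP[w3 we].
have [->|wn0] := eqVneq w 0.
  by rewrite subrr sub0r mulr0 oppr0 cabs0 mulr0.
have w0 : 0 < cabs w by rewrite cabs_gt0.
pose g : R[i]^o -> R[i]^o := fun y =>
  f y - (tcoef rho f 0 + tcoef rho f 1 * y + tcoef rho f 2 * y ^+ 2).
have wr : cabs w < r by move: w3 rhor rho0; lra.
have -> : derive1 f w - derive1 f 0 - 2 * tcoef rho f 2 * w = derive1 g w.
  by rewrite f'0 (derive1_sub_quadratic _ _ _ (df w wr)).2.
have gle (z : R[i]) : cabs (z - w) = cabs w / 2 ->
    cabs (g z) <= C * (3 / 2 * cabs w) ^+ 3.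
  move=> zw; have zle : cabs z <= 3 / 2 * cabs w.
    have -> : z = (z - w) + w by ring.
    by apply: (le_trans (cabsD _ _)); rewrite zw; lra.
  have z2 : cabs z <= rho / 2 by move: w3 zle; lra.
  apply: (le_trans (taylor2 df rho0 rhor fM z2)); rewrite -/C.
  rewrite ler_wpM2l //; apply: lerXn2r; rewrite ?nnegrE ?cabs_ge0 //.
  by rewrite mulr_ge0 ?cabs_ge0.
have dg (z : R[i]) : cabs (z - w) < cabs w -> derivable g z 1.
  move=> zw; apply: (derive1_sub_quadratic _ _ _ _).1; apply: df.
  have -> : z = (z - w) + w by ring.
  by apply: (le_lt_trans (cabsD _ _)); move: w3 rhor rho0 zw; lra.
have w20 : 0 < cabs w / 2 by rewrite divr_gt0.
have w2w : cabs w / 2 < cabs w by move: w0; lra.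
apply: (le_trans (cauchy_estimate w20 w2w dg gle)).
have -> : 2 * (C * (3 / 2 * cabs w) ^+ 3 / (cabs w / 2)) =
  27 / 2 * C * cabs w * cabs w by field; rewrite gt_eqF.
rewrite ler_pM2r //; rewrite ltr_pdivlMr // in we.
by have := mulr_ge0 C0 (ltW w0); move: we w0; nra.
Qed.


Let conv0 (c p : nat -> R[i]) := c 0%N * p 0%N.
Let conv1 (c p : nat -> R[i]) := c 0%N * p 1%N + c 1%N * p 0%N.
Let conv2 (c p : nat -> R[i]) := c 0%N * p 2%N + c 1%N * p 1%N + c 2%N * p 0%N.

Let poly2 (p : nat -> R[i]) (z : R[i]) := p 0%N + p 1%N * z + p 2%N * z ^+ 2.

Let ccont_poly2 rho p : ccont (fun t => poly2 p (circ rho t)).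
Proof.
have cc := ccont_circ rho.
apply: (ccontD (ccontD (ccont_cst _) (ccontM (ccont_cst _) cc))).
exact: ccontM (ccont_cst _) (ccontX 2 cc).
Qed.

(* On the circle [conj z = rho^2 / z], so the integrand is a combination of
   [f(z) z^k] with [-2 <= k <= 2], and those with [k > 0] have mean zero. *)
Let cmean_pairing r rho f (p q : nat -> R[i]) : holo r f -> 0 < rho -> rho < r ->
  let c := tcoef rho f in let z := circ rho in let r2 := ((rho ^+ 2)%:C)%C in
  cmean (fun t => f (z t) * poly2 p (z t) * (poly2 q (z t))^*%C) =
  conv0 c p * (q 0%N)^*%C + r2 * conv1 c p * (q 1%N)^*%C +
  r2 ^+ 2 * conv2 c p * (q 2%N)^*%C.
Proof.
move=> df rho0 rhor c z r2.
have cf : ccont (fun t => f (z t)) := ccont_holo df rho0 rhor.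
have cz : ccont z := ccont_circ rho.
have cpos n : ccont (fun t => f (z t) * z t ^+ n).
  by apply: ccontM => //; exact: ccontX.
have cneg n := ccont_tcoef n df rho0 rhor.
have cZ (k : R[i]) u : ccont u -> ccont (fun t => k * u t).
  by move=> cu; apply: ccontM => //; exact: ccont_cst.
transitivity (cmean (fun t =>
  (p 0%N * (q 0%N)^*%C + p 1%N * (q 1%N)^*%C * r2 + p 2%N * (q 2%N)^*%C * r2 ^+ 2) *
    (f (z t) * (z t)^-1 ^+ 0) +
  (p 0%N * (q 1%N)^*%C * r2 + p 1%N * (q 2%N)^*%C * r2 ^+ 2) * (f (z t) * (z t)^-1 ^+ 1) +
  (p 0%N * (q 2%N)^*%C * r2 ^+ 2) * (f (z t) * (z t)^-1 ^+ 2) +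
  (p 1%N * (q 0%N)^*%C + p 2%N * (q 1%N)^*%C * r2) * (f (z t) * z t ^+ 1) +
  (p 2%N * (q 0%N)^*%C) * (f (z t) * z t ^+ 2))).
  congr cmean; apply/funext => t.
  have z0 : z t != 0 by exact: circ_neq0.
  have zJ : (z t)^*%C = r2 / z t by rewrite /r2 -(circJ rho t) mulfK.
  have cD (a b : R[i]) : (a + b)^*%C = a^*%C + b^*%C by exact: rmorphD.
  have cX (a : R[i]) : (a ^+ 2)^*%C = a^*%C ^+ 2 by exact: rmorphXn.
  rewrite /poly2 !cD (conjcM (q 2)) cX conjcM zJ.
  by field.
have e0 k := cZ k _ (cneg 0%N); have e1 k := cZ k _ (cneg 1%N).
have e2 k := cZ k _ (cneg 2%N); have e3 k := cZ k _ (cpos 1%N).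
have e4 k := cZ k _ (cpos 2%N).
rewrite (cmeanD (ccontD (ccontD (ccontD (e0 _) (e1 _)) (e2 _)) (e3 _)) (e4 _)).
rewrite (cmeanD (ccontD (ccontD (e0 _) (e1 _)) (e2 _)) (e3 _)).
rewrite (cmeanD (ccontD (e0 _) (e1 _)) (e2 _)) (cmeanD (e0 _) (e1 _)).
rewrite !(cmeanZ _ (cneg _)) !(cmeanZ _ (cpos _)) !(cmean_holo_pow _ df rho0 rhor).
rewrite -/(tcoef rho f 0) -/(tcoef rho f 1) -/(tcoef rho f 2).
by rewrite -/c /conv0 /conv1 /conv2; ring.
Qed.

Let holo1 r : holo r (fun=> 1).
Proof. by move=> z _; exact: derivable_cst. Qed.

(** With [f = 1], [cmean_pairing] becomes Parseval's identity for quadratic polynomials. For [n > 0]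
    the mean of [z^-n] vanishes because it is, up to a power of [rho^2], the conjugate of the mean
    of [z^n]. *)
Let tcoef_one rho n : 0 < rho -> tcoef rho (fun=> 1) n = (n == 0%N)%:R.
Proof.
move=> rho0; have rr : rho < rho + 1 by rewrite ltrDl.
case: n => [|n]; first by rewrite (tcoef0 (@holo1 (rho + 1)) rho0 rr).
have := cmean_holo_pow n (@holo1 (rho + 1)) rho0 rr => /(congr1 conjc).
have cc : ccont (fun t => 1 * circ rho t ^+ n.+1).
  by apply: ccontM; [exact: ccont_cst|apply: ccontX; exact: ccont_circ].
rewrite conjc0 -cmeanJ //= => E.
have ci : ccont (fun t => 1 * (circ rho t)^-1 ^+ n.+1 : R[i]).
  apply: ccontM; first exact: ccont_cst.
  by apply: ccontX; apply: ccontV (ccont_circ rho) => t; exact: circ_neq0.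
have r2 : ((rho ^+ 2)%:C)%C ^+ n.+1 != 0 :> R[i].
  by rewrite expf_neq0 // -cabs_gt0 cabs_real normr_gt0 expf_neq0 // gt_eqF.
apply: (mulfI r2); rewrite mulr0 /tcoef -cmeanZ // -[RHS]E.
congr cmean; apply/funext => t; rewrite conjcM conjc1 !mul1r.
have -> : (circ rho t ^+ n.+1)^*%C = (circ rho t)^*%C ^+ n.+1 by exact: rmorphXn.
by rewrite -exprMn -(circJ rho t) mulfK // circ_neq0.
Qed.

(* Bessel's inequality for [f p] against its projection onto [1, z, z^2]. *)
Lemma toeplitz_bessel r rho f (M : R) (x0 x1 x2 : R[i]) :
  holo r f -> 0 < rho -> rho < r -> 0 <= M ->
  (forall t, cabs (f (circ rho t)) <= M) ->
  cabs (tcoef rho f 0 * x2) ^+ 2 +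
    rho ^+ 2 * cabs (tcoef rho f 0 * x1 + tcoef rho f 1 * x2) ^+ 2 +
    rho ^+ 4 * cabs (tcoef rho f 0 * x0 + tcoef rho f 1 * x1 + tcoef rho f 2 * x2) ^+ 2 <=
  M ^+ 2 * (cabs x2 ^+ 2 + rho ^+ 2 * cabs x1 ^+ 2 + rho ^+ 4 * cabs x0 ^+ 2).
Proof.
move=> df rho0 rhor M0 fM; set c := tcoef rho f.
(* The vector is read backwards: the components of the upper triangular product are then the first
   Taylor coefficients of [f p], collected in [q]. *)
pose p := nth (0 : R[i]) [:: x2; x1; x0].
pose q := nth (0 : R[i]) [:: c 0%N * x2; c 0%N * x1 + c 1%N * x2;
   c 0%N * x0 + c 1%N * x1 + c 2%N * x2].
pose z := circ rho; pose P t := poly2 p (z t); pose Q t := poly2 q (z t).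
have cP : ccont P by exact: ccont_poly2.
have cQ : ccont Q by exact: ccont_poly2.
have cf : ccont (fun t => f (z t)) := ccont_holo df rho0 rhor.
have c1 : ccont (fun=> 1 : R[i]) by exact: ccont_cst.
have sq (a : R[i]) : a * a^*%C = ((cabs a ^+ 2)%:C)%C by rewrite mulcJ.
pose N (y : nat -> R[i]) : R[i] := ((cabs (y 0%N) ^+ 2 + rho ^+ 2 * cabs (y 1%N) ^+ 2 +
   rho ^+ 4 * cabs (y 2%N) ^+ 2)%:C)%C.
have NE y : N y = y 0%N * (y 0%N)^*%C + ((rho ^+ 2)%:C)%C * y 1%N * (y 1%N)^*%C +
   ((rho ^+ 2)%:C)%C ^+ 2 * y 2%N * (y 2%N)^*%C.
  have key (a b d k : R) : ((a + k * b + k ^+ 2 * d)%:C)%C =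
      (a%:C)%C + (k%:C)%C * (b%:C)%C + (k%:C)%C ^+ 2 * (d%:C)%C :> R[i].
    by rewrite [(k%:C)%C ^+ 2]expr2; apply: complex_eqP => /=; ring.
  have sqM (k a : R[i]) : k * a * a^*%C = k * ((cabs a ^+ 2)%:C)%C.
    by rewrite -sq mulrA.
  by rewrite !sqM sq /N -key -exprM.
have one y : cmean (fun t => 1 * poly2 y (z t) * (poly2 y (z t))^*%C) = N y.
  rewrite (cmean_pairing _ _ (@holo1 (rho + 1))) ?ltrDl //.
  by rewrite /conv0 /conv1 /conv2 !tcoef_one //= NE; congr (_ + _ + _); ring.
have fPQ : cmean (fun t => f (z t) * P t * (Q t)^*%C) = N q.
  by rewrite (cmean_pairing _ _ df rho0 rhor) NE.
pose h t : R[i] := ((M ^+ 2)%:C)%C * (1 * P t * (P t)^*%C) - f (z t) * P t * (Q t)^*%C -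
   (f (z t) * P t * (Q t)^*%C)^*%C + 1 * Q t * (Q t)^*%C.
have ccPP : ccont (fun t => 1 * P t * (P t)^*%C).
  by apply: ccontM; [exact: ccontM|exact: ccontJ].
have ccQQ : ccont (fun t => 1 * Q t * (Q t)^*%C).
  by apply: ccontM; [exact: ccontM|exact: ccontJ].
have ccPQ : ccont (fun t => f (z t) * P t * (Q t)^*%C).
  by apply: ccontM; [exact: ccontM|exact: ccontJ].
have ccM : ccont (fun t => ((M ^+ 2)%:C)%C * (1 * P t * (P t)^*%C)).
  by apply: ccontM => //; exact: ccont_cst.
have ch : ccont h.
  by apply: ccontD => //; apply: ccontB; [exact: ccontB|exact: ccontJ].
have hE : cmean h = ((M ^+ 2)%:C)%C * N p - N q.
  rewrite /h cmeanD //; last by apply: ccontB; [exact: ccontB|exact: ccontJ].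
  rewrite cmeanB; [|exact: ccontB|exact: ccontJ].
  rewrite cmeanB // cmeanJ // fPQ cmeanZ // /P /Q !one.
  by rewrite /N !conjc_real; ring.
have h0 t : 0 <= complex.Re (h t).
  have -> : h t = ((M ^+ 2 * cabs (P t) ^+ 2 - cabs (f (z t) * P t) ^+ 2 +
     cabs (f (z t) * P t - Q t) ^+ 2)%:C)%C.
    rewrite rmorphD rmorphB (rmorphM _ (M ^+ 2)) /= -!sq /h.
    by rewrite conjcB !conjcM conjcK; ring.
  rewrite /= addr_ge0 ?sqr_ge0 // subr_ge0 cabsM exprMn ler_wpM2r ?sqr_ge0 //.
  by apply: lerXn2r; rewrite ?nnegrE ?cabs_ge0 //.
have := Re_cmean_ge0 ch h0; rewrite hE /N /= mul0r subr0.
by rewrite subr_ge0.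
Qed.

End CoefficientBound.

(** * Norm of f(A) *)

Section OperatorNorm.
Variable R : realType.
Implicit Types (r rho : R) (f : R[i]^o -> R[i]^o).

Definition i0 : 'I_3 := @Ordinal 3 0 isT.
Definition i1 : 'I_3 := @Ordinal 3 1 isT.
Definition i2 : 'I_3 := @Ordinal 3 2 isT.

Lemma sum_ord3 (V : nmodType) (F : 'I_3 -> V) : \sum_i F i = F i0 + F i1 + F i2.
Proof.
rewrite !big_ord_recl big_ord0 addr0 addrA; congr (F _ + F _ + F _); exact: val_inj.
Qed.

Lemma ord3_ind (P : 'I_3 -> Prop) : P i0 -> P i1 -> P i2 -> forall i, P i.
Proof.
move=> P0 P1 P2 [[|[|[|//]]] ni].
- by rewrite (_ : Ordinal ni = i0) //; exact: val_inj.
- by rewrite (_ : Ordinal ni = i1) //; exact: val_inj.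
- by rewrite (_ : Ordinal ni = i2) //; exact: val_inj.
Qed.

Lemma vnorm3 (x : 'cV[R[i]]_3) : vnorm x ^+ 2 =
  cabs (x i0 0) ^+ 2 + cabs (x i1 0) ^+ 2 + cabs (x i2 0) ^+ 2.
Proof.
rewrite /vnorm sqr_sqrtr; last by apply: sumr_ge0 => i _; rewrite addr_ge0 // sqr_ge0.
by rewrite sum_ord3 !cabs_sqr.
Qed.

Lemma vnorm_ge0 n (x : 'cV[R[i]]_n) : 0 <= vnorm x.
Proof. exact: sqrtr_ge0. Qed.

Lemma vnorm_delta (i : 'I_3) : vnorm (delta_mx i 0 : 'cV[R[i]]_3) = 1.
Proof.
apply/eqP; rewrite -(@eqrXn2 _ 2) ?vnorm_ge0 // vnorm3 expr1n !mxE.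
by elim/ord3_ind: i; rewrite /= ?cabs1 ?cabs0 !expr0n ?expr1n /= ?addr0 ?add0r.
Qed.

Lemma opnorm_le (A : 'M[R[i]]_3) (K : R) :
  (forall x, vnorm x = 1 -> vnorm (A *m x) <= K) -> opnorm A <= K.
Proof.
move=> HK; apply: ge_sup => [|_ [x /= x1 <-]]; last exact: HK.
by exists (vnorm (A *m delta_mx i0 0)), (delta_mx i0 0) => //; exact: vnorm_delta.
Qed.

Lemma le_opnorm (A : 'M[R[i]]_3) (K : R) (x : 'cV[R[i]]_3) :
  (forall x, vnorm x = 1 -> vnorm (A *m x) <= K) -> vnorm x = 1 ->
  vnorm (A *m x) <= opnorm A.
Proof.
move=> HK x1; apply: ub_le_sup; last by exists x.
by exists K => _ [y /= y1 <-]; exact: HK.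
Qed.

(** Passage to the limit [rho -> r]: if the conclusion failed, the midpoint of [sqrt (M / Y)] and
    [r] would violate the hypothesis. *)
Lemma mul_sqr_le_lim (Y M r : R) : 0 < r -> 0 <= M ->
  (forall rho, 0 < rho -> rho < r -> Y * rho ^+ 2 <= M) -> Y * r ^+ 2 <= M.
Proof.
move=> r0 M0 H; rewrite leNgt; apply/negP => MY.
have Y0 : 0 < Y.
  by rewrite -(pmulr_lgt0 _ (exprn_gt0 2 r0)) (le_lt_trans M0).
pose s := Num.sqrt (M / Y).
have s0 : 0 <= s by exact: sqrtr_ge0.
have ss : s ^+ 2 = M / Y by rewrite sqr_sqrtr // divr_ge0 // ltW.
have sr : s < r.
  rewrite -(@ltr_pXn2r _ 2) ?nnegrE ?(ltW r0) //.
  by rewrite ss ltr_pdivrMr // mulrC.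
have rho0 : 0 < (s + r) / 2 by move: s0 r0; lra.
have rhor : (s + r) / 2 < r by move: sr; lra.
have := H _ rho0 rhor; rewrite mulrC -ler_pdivlMr // -ss leNgt => /negP; apply.
rewrite ltr_pXn2r ?nnegrE ?(ltW rho0) //; move: sr; lra.
Qed.

Lemma matfun_jordan3_mul r rho f (x : 'cV[R[i]]_3) : holo r f -> 0 < rho -> rho < r ->
  (exists M : R, forall t, cabs (f (circ rho t)) <= M) ->
  let c := tcoef rho f in let y := matfun_jordan f 3 0 *m x in
  [/\ y i0 0 = c 0%N * x i0 0 + c 1%N * x i1 0 + c 2 * x i2 0,
      y i1 0 = c 0%N * x i1 0 + c 1%N * x i2 0 & y i2 0 = c 0%N * x i2 0].
Proof.
move=> df rho0 rhor fM c y.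
have e0 : f 0 = c 0%N by rewrite /c (tcoef0 df).
have e1 : derive1 f 0 = c 1%N by rewrite (derive1_tcoef df rho0 rhor fM).
have e2 : derive1 (cderiv f) 0 / 2 = c 2.
  by rewrite /cderiv (derive2_tcoef df rho0 rhor fM) mulrAC divff ?mul1r.
split; rewrite /y mxE sum_ord3 !mxE /= /cderivn /=.
- by rewrite /cderiv e0 e1 e2 !divr1.
- by rewrite /cderiv e0 e1 !divr1; ring.
- by rewrite /cderiv e0 !divr1; ring.
Qed.

(** [toeplitz_bessel] bounds [y = f(A) x] in the weighted norm
    [|y2|^2 + rho^2 |y1|^2 + rho^4 |y0|^2]. For [rho <= 1] this lies between [rho^4 |y|^2] and
    [|y|^2], so that the return to [vnorm] costs [rho^-2]. *)
Lemma opnorm_matfun_le r f (M : R) : 0 < r -> r <= 1 -> holo r f ->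
  (forall z : R[i], cabs z < r -> cabs (f z) <= M) ->
  opnorm (matfun_jordan f 3 0) <= M / r ^+ 2.
Proof.
move=> r0 r1 df fM; apply: opnorm_le => x x1.
have M0 : 0 <= M by apply: le_trans (fM 0 _); rewrite ?cabs_ge0 ?cabs0.
rewrite ler_pdivlMr ?exprn_gt0 //; apply: mul_sqr_le_lim => // rho rho0 rhor.
have fMt t : cabs (f (circ rho t)) <= M by apply: fM; rewrite cabs_circ.
have [y0 y1 y2] := matfun_jordan3_mul x df rho0 rhor (ex_intro _ M fMt).
have B := toeplitz_bessel (x i0 0) (x i1 0) (x i2 0) df rho0 rhor M0 fMt.
rewrite -y0 -y1 -y2 in B.
rewrite -(@ler_pXn2r _ 2) ?nnegrE ?mulr_ge0 ?vnorm_ge0 ?exprn_ge0 ?(ltW rho0) //.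
rewrite exprMn vnorm3 -exprM.
move: (vnorm3 x); rewrite x1 expr1n => xE.
have rho1 : rho <= 1 by apply: le_trans r1; exact: ltW.
have rho2 : rho ^+ 2 <= 1 by rewrite exprn_ile1 // ltW.
have rho4 : rho ^+ 4 <= 1 by rewrite exprn_ile1 // ltW.
have rho42 : rho ^+ 4 <= rho ^+ 2.
  by rewrite -[4%N]/((2 + 2)%N) exprD ler_piMl // exprn_ge0 // ltW.
apply: le_trans (_ : M ^+ 2 * 1 <= _); last by rewrite mulr1.
move: B; set Y0 := cabs (_ i0 0) ^+ 2; set Y1 := cabs (_ i1 0) ^+ 2.
set Y2 := cabs (_ i2 0) ^+ 2 => B.
have Y1p : 0 <= Y1 by exact: sqr_ge0.
have Y2p : 0 <= Y2 by exact: sqr_ge0.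
apply: le_trans (_ : Y2 + rho ^+ 2 * Y1 + rho ^+ 4 * Y0 <= _).
  by have := ler_wpM2r Y1p rho42; have := ler_wpM2r Y2p rho4; lra.
apply: (le_trans B); rewrite ler_wpM2l ?sqr_ge0 // xE.
rewrite addrC [leRHS]addrAC -addrA [leRHS]addrC.
by rewrite addrC lerD // ?lerD // ler_piMl ?sqr_ge0.
Qed.

Lemma opnorm_div_supnorm_le r f : 0 < r -> r <= 1 -> holo r f ->
  opnorm (matfun_jordan f 3 0) / supnorm r f <= (r ^+ 2)^-1.
Proof.
move=> r0 r1 df; have rr : 0 <= (r ^+ 2)^-1 by rewrite invr_ge0 exprn_ge0 // ltW.
rewrite /supnorm; set S := [set _ | _ in _].
have S0 : S (cabs (f 0)) by exists 0 => //; rewrite /odisk /= cabs0.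
(* An unbounded set has [sup] equal to 0 by default, and division by 0 gives 0; the case [sup S = 0]
   below ends in the same way. *)
have [bS|nbS] := pselect (has_ubound S); last first.
  by rewrite sup_out ?invr0 ?mulr0 // => -[_].
have fS (z : R[i]) : cabs z < r -> cabs (f z) <= sup S.
  by move=> zr; apply: ub_le_sup => //; exists z.
have : 0 <= sup S by apply: le_trans (fS 0 _); rewrite ?cabs_ge0 ?cabs0.
rewrite le_eqVlt => /predU1P[<-|S1]; first by rewrite invr0 mulr0.
by rewrite ler_pdivrMr // mulrC opnorm_matfun_le.
Qed.

(** * The extremal function [z^2] *)

Let sqrC : R[i]^o -> R[i]^o := fun z => z ^+ 2.

Let sqrC_deriv (z : R[i]) : derivable sqrC z 1 /\ derive1 sqrC z = 2 * z.
Proof.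
have d0 : derivable (fun=> 0 : R[i]^o) (z : R[i]^o) 1 by exact: derivable_cst.
have := derive1_sub_quadratic 0 0 (- 1) d0.
have -> : (fun y : R[i]^o => 0 - (0 + 0 * y + -1 * y ^+ 2) : R[i]^o) = sqrC.
  by apply/funext => y; rewrite /sqrC; ring.
by rewrite derive1_cst => -[? ->]; split => //; ring.
Qed.

Let sqrC_deriv2 : derive1 (cderiv sqrC) 0 = 2.
Proof.
have d0 : derivable (fun=> 0 : R[i]^o) (0 : R[i]^o) 1 by exact: derivable_cst.
have := derive1_sub_quadratic 0 (- 2) 0 d0.
have -> : (fun y : R[i]^o => 0 - (0 + - 2 * y + 0 * y ^+ 2) : R[i]^o) = cderiv sqrC.
  by apply/funext => y; rewrite /cderiv (sqrC_deriv y).2; ring.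
by rewrite derive1_cst => -[_ ->]; ring.
Qed.

Lemma admissible_sqr r : admissible r sqrC.
Proof.
split; first by move=> z _; exact: (sqrC_deriv z).1.
apply: continuous_subspaceT => z; apply: differentiable_continuous.
by apply/derivable1_diffP; exact: (sqrC_deriv z).1.
Qed.

(** The supremum over the open disk is not attained; the values [rho^2] at real points [rho < r]
    approach it, and [mul_sqr_le_lim] with [Y = 1] concludes. *)
Lemma supnorm_sqr r : 0 < r -> supnorm r sqrC = r ^+ 2.
Proof.
move=> r0; have r20 : 0 <= r ^+ 2 by rewrite exprn_ge0 // ltW.
have ub : ubound [set cabs (sqrC z) | z in odisk r] (r ^+ 2).
  move=> _ [z zr <-]; rewrite /sqrC cabsX.
  by apply: lerXn2r; rewrite ?nnegrE ?cabs_ge0 ?(ltW r0) // ltW.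
have mem (rho : R) : 0 < rho -> rho < r ->
    [set cabs (sqrC z) | z in odisk r] (rho ^+ 2).
  move=> rho0 rhor; exists (rho%:C)%C.
    by rewrite /odisk /= cabs_real gtr0_norm.
  by rewrite /sqrC cabsX cabs_real gtr0_norm.
have le_sup (rho : R) : 0 < rho -> rho < r -> 1 * rho ^+ 2 <= supnorm r sqrC.
  by move=> rho0 rhor; rewrite mul1r; apply: ub_le_sup; [exists (r ^+ 2)|exact: mem].
have r2 : 0 < r / 2 by rewrite divr_gt0.
have r2r : r / 2 < r by move: r0; lra.
apply/eqP; rewrite eq_le; apply/andP; split.
  by apply: ge_sup => //; exists ((r / 2) ^+ 2); exact: mem.
rewrite -[leLHS]mul1r; apply: mul_sqr_le_lim => //.
by apply: le_trans (le_sup _ r2 r2r); rewrite mul1r sqr_ge0.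
Qed.

(** Here [f(A) = A^2] maps [(x0, x1, x2)] to [(x2, 0, 0)], and the last basis vector attains the
    norm. *)
Lemma opnorm_sqr : opnorm (matfun_jordan sqrC 3 0) = 1.
Proof.
have mul (x : 'cV[R[i]]_3) : [/\ (matfun_jordan sqrC 3 0 *m x) i0 0 = x i2 0,
    (matfun_jordan sqrC 3 0 *m x) i1 0 = 0 & (matfun_jordan sqrC 3 0 *m x) i2 0 = 0].
  have s0 : sqrC 0 = 0 by rewrite /sqrC expr0n.
  have s1 : derive1 sqrC 0 = 0 by rewrite (sqrC_deriv 0).2 mulr0.
  have s2 := sqrC_deriv2; rewrite /cderiv in s2.
  split; rewrite mxE sum_ord3 !mxE /= /cderivn /= /cderiv.
  - by rewrite s0 s1 s2 divff ?mul0r ?add0r ?mul1r.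
  - by rewrite s0 s1 !mul0r !add0r.
  - by rewrite s0 !mul0r !add0r.
have nE (x : 'cV[R[i]]_3) : vnorm (matfun_jordan sqrC 3 0 *m x) = cabs (x i2 0).
  have [m0 m1 m2] := mul x.
  apply/eqP; rewrite -(@eqrXn2 _ 2) ?vnorm_ge0 ?cabs_ge0 // vnorm3 m0 m1 m2.
  by rewrite cabs0 !expr0n /= !addr0.
have le1 (x : 'cV[R[i]]_3) : vnorm x = 1 -> vnorm (matfun_jordan sqrC 3 0 *m x) <= 1.
  move=> x1; rewrite nE -(@ler_pXn2r _ 2) ?nnegrE ?cabs_ge0 //.
  by rewrite -x1 vnorm3 lerDr addr_ge0 // sqr_ge0.
apply/eqP; rewrite eq_le opnorm_le //=.
have := le_opnorm le1 (vnorm_delta i2).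
by rewrite nE mxE /= cabs1.
Qed.

End OperatorNorm.

(** * The defect delta *)

Section SmallestEigenvalue.
Variables (R : realType) (r : R).
Hypotheses (r0 : 0 < r) (r1 : r <= 1).

Let A : 'M[R[i]]_3 := jordan_block 3 0.
Let tau (s : R) : R[i] := (circ r (s / r))^-1.
Let k0 : R := (2 * pi * r)^-1.
Let a : R := r^-1.

Let sigma_neq0 s : circ r (s / r) != 0. Proof. exact: circ_neq0. Qed.
Let k0_gt0 : 0 < k0.
Proof. by rewrite invr_gt0 !mulr_gt0 // pi_gt0. Qed.

Lemma dsigmaE s : dsigma r s = 'i%C * circ r (s / r) / (r%:C)%C.
Proof.
have rn0 : r != 0 by rewrite gt_eqF.
have dl : is_derive s 1 (fun t : R => t / r) r^-1.
  have := is_derive_scale r^-1 (is_derive_id s (1 : R)); rewrite mulr1.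
  have -> // : (fun y : R => r^-1 * id y) = (fun t : R => t / r).
  by apply/funext => y; rewrite mulrC.
have E1 : derive1 (fun t => complex.Re (sigma r t)) s = - sin (s / r).
  rewrite derive1E.
  have := is_derive_scale r (@is_derive1_comp _ cos (fun t : R => t / r) s _ _
    (is_derive_cos (s / r)) dl).
  by move=> /@derive_val; rewrite /comp => ->; field.
have E2 : derive1 (fun t => complex.Im (sigma r t)) s = cos (s / r).
  rewrite derive1E.
  have := is_derive_scale r (@is_derive1_comp _ sin (fun t : R => t / r) s _ _
    (is_derive_sin (s / r)) dl).
  by move=> /@derive_val; rewrite /comp => ->; field.
have rC : (r%:C)%C != 0 :> R[i] by rewrite -cabs_gt0 cabs_real normr_gt0.
apply: (mulIf rC); rewrite divfK // /dsigma E1 E2.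
by apply: complex_eqP => /=; ring.
Qed.

(** The Neumann series of the nilpotent [A] is finite; it suffices to check one product. *)
Lemma resolventE s : invmx (sigma r s *: 1%:M - A) =
  \matrix_(i, j) (if (i <= j)%N then tau s ^+ (j - i).+1 else 0).
Proof.
set N := \matrix_(i, j) _; set B := _ - A.
have z0 := sigma_neq0 s.
have BN : B *m N = 1%:M.
  apply/matrixP => i j; rewrite mxE sum_ord3 !mxE.
  rewrite -[sigma r s]/(circ r (s / r)) /tau.
  by elim/ord3_ind: i; elim/ord3_ind: j => /=; field.
have [Bu _] := mulmx1_unit BN.
by rewrite -[LHS]mulmx1 -BN mulmxA mulVmx // mul1mx.
Qed.

(** Since [sigma' = i sigma / r], the scalar factor is [sigma / (2 pi r) = k0 / tau], which removes
    one power of [tau] from each entry of the resolvent; the diagonal becomes real and is doubled by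
    the adjoint. *)
Lemma mu_mxE s : mu_mx r A s = (k0%:C)%C *:
  \matrix_(i, j) (if i == j then 2 else if (i <= j)%N then tau s ^+ (j - i)
                  else (tau s)^*%C ^+ (i - j)).
Proof.
have z0 := sigma_neq0 s.
have rC : (r%:C)%C != 0 :> R[i] by rewrite -cabs_gt0 cabs_real gtr0_norm.
have pC : (pi%:C)%C != 0 :> R[i] by rewrite -cabs_gt0 cabs_real gtr0_norm pi_gt0.
have iC : ('i%C : R[i]) != 0 by rewrite -cabs_gt0 cabs_i.
have cE : dsigma r s / (2 * (pi%:C)%C * 'i%C) = (k0%:C)%C * (tau s)^-1.
  rewrite dsigmaE /tau /k0 invrK fmorphV !rmorphM /= rmorph_nat.
  by move: pC; move: (pi%:C)%C => q qC; field; rewrite rC qC iC.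
rewrite /mu_mx cE resolventE /ctrmx.
have t0 : tau s != 0 by rewrite invr_eq0.
apply/matrixP => i j; rewrite !mxE.
have tE n : (k0%:C)%C * (tau s)^-1 * tau s ^+ n.+1 = (k0%:C)%C * tau s ^+ n.
  by rewrite exprS mulrA mulfVK.
have tJ n : ((k0%:C)%C * (tau s)^-1 * tau s ^+ n.+1)^*%C =
    (k0%:C)%C * (tau s)^*%C ^+ n.
  by rewrite tE conjcM conjc_real; congr (_ * _); exact: rmorphXn.
have J0 (x : R[i]) : (x * 0)^*%C = 0 by rewrite mulr0 conjc0.
have cJ (x : R[i]) : Num.conj x = x^*%C by [].
rewrite cJ -(val_eqE i j) -[val i]/(nat_of_ord i) -[val j]/(nat_of_ord j).
case: (ltngtP i j) => ij; rewrite ?J0 ?tJ ?tE.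
- by rewrite addr0.
- by rewrite mulr0 add0r.
- by rewrite ij subnn !expr0; ring.
Qed.

Lemma tauJ s : (tau s)^*%C = (a%:C)%C ^+ 2 / tau s.
Proof.
rewrite /tau invrK conjc_inv; have := circJ r (s / r).
have zJ : (circ r (s / r))^*%C != 0 by rewrite conjc_eq0.
have rC : (r%:C)%C != 0 :> R[i] by rewrite -cabs_gt0 cabs_real gtr0_norm.
rewrite /a fmorphV rmorphXn /= => E.
by apply: (mulfI zJ); rewrite divff // mulrCA E exprVn mulVf // expf_neq0.
Qed.

(* The rotation [u_k = v_k (a / tau)^k] turns the eigenvalue equation of
   [mu_mx] into that of the real matrix [[0,a,a^2],[a,0,a],[a^2,a,0]]. *)
Lemma eigenvalue_mu s (x : R[i]) : eigenvalue (mu_mx r A s) x <->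
  exists u0 u1 u2 : R[i], [|| u0 != 0, u1 != 0 | u2 != 0] /\
    let k := x / (k0%:C)%C - 2 in let b := (a%:C)%C in
    [/\ b * u1 + b ^+ 2 * u2 = k * u0, b * u0 + b * u2 = k * u1 &
        b ^+ 2 * u0 + b * u1 = k * u2].
Proof.
have t0 : tau s != 0 by rewrite invr_eq0.
have b0 : (a%:C)%C != 0 :> R[i].
  by rewrite -cabs_gt0 cabs_real normr_gt0 invr_eq0 gt_eqF.
have k0C : (k0%:C)%C != 0 :> R[i] by rewrite -cabs_gt0 cabs_real gtr0_norm.
rewrite mu_mxE; move: (tau s) t0 (tauJ s) => t t0 tJ; set H := _ *: _.
set b := (a%:C)%C.
have mulE (v : 'rV[R[i]]_3) j : (v *m H) 0 j =
    v 0 i0 * H i0 j + v 0 i1 * H i1 j + v 0 i2 * H i2 j.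
  by rewrite mxE sum_ord3.
split=> [/eigenvalueP[v vx v0]|[u0 [u1 [u2 [un0 [e0 e1 e2]]]]]].
- have E j : v 0 i0 * H i0 j + v 0 i1 * H i1 j +
      v 0 i2 * H i2 j = x * v 0 j by rewrite -mulE vx mxE.
  exists (v 0 i0), (v 0 i1 * (b / t)), (v 0 i2 * (b / t) ^+ 2); split.
    apply: contraR v0; rewrite !negb_or !negbK => /and3P[/eqP v0].
    rewrite !mulf_eq0 invr_eq0 (negPf b0) (negPf t0) /= !orbF.
    move=> /eqP v1 /eqP v2; apply/eqP/rowP; elim/ord3_ind; by rewrite mxE.
  have := E i0; have := E i1; have := E i2; rewrite /H !mxE /= tJ -/b.
  move: (v 0 i0) (v 0 i1) (v 0 i2) => v0' v1 v2 E2 E1 E0.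
  split.
  + have -> : (x / (k0%:C)%C - 2) * v0' = x * v0' / (k0%:C)%C - 2 * v0' by ring.
    by rewrite -E0; field; rewrite t0 k0C.
  + have -> : (x / (k0%:C)%C - 2) * (v1 * (b / t)) =
      (x * v1 / (k0%:C)%C - 2 * v1) * (b / t) by ring.
    by rewrite -E1; field; rewrite t0 k0C.
  + have -> : (x / (k0%:C)%C - 2) * (v2 * (b / t) ^+ 2) =
      (x * v2 / (k0%:C)%C - 2 * v2) * (b / t) ^+ 2 by ring.
    by rewrite -E2; field; rewrite t0 k0C.
- apply/eigenvalueP.
  pose v : 'rV[R[i]]_3 := \row_j nth 0 [:: u0; u1 * (t / b); u2 * (t / b) ^+ 2] j.
  have xE y : x * y = (k0%:C)%C * ((x / (k0%:C)%C - 2) * y + 2 * y) by field.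
  exists v.
    apply/rowP => j; rewrite mulE [RHS]mxE xE /H.
    elim/ord3_ind: j; rewrite !mxE /= ?tJ -/b ?mulrA -?e0 -?e1 -?e2;
      by field; rewrite ?t0 ?b0.
  apply: contraL un0 => /eqP/rowP v0; rewrite !negb_or !negbK.
  have := v0 i0; have := v0 i1; have := v0 i2; rewrite !mxE /= => /eqP h2 /eqP h1 ->.
  move: h1 h2; rewrite !mulf_eq0 invr_eq0 (negPf b0) (negPf t0) /=.
  by rewrite !orbF eqxx => -> ->.
Qed.

(** In the rotated real matrix, [(1, 0, -1)] has eigenvalue [- a^2]. If [k < - a^2], subtracting the
    outer equations gives [(k + a^2) (u0 - u2) = 0], so [u0 = u2] and [k (k - a^2) = 2 a^2]; but the
    left side exceeds [2 a^4], which is at least [2 a^2] as [a >= 1]. *)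
Lemma lambda_min_mu s : lambda_min (mu_mx r A s) = k0 * (2 - a ^+ 2).
Proof.
have a1 : 1 <= a by rewrite /a invf_ge1.
have a0 : 0 < a by rewrite invr_gt0.
have k0C : (k0%:C)%C != 0 :> R[i] by rewrite -cabs_gt0 cabs_real gtr0_norm.
have b0 : (a%:C)%C != 0 :> R[i] by rewrite -cabs_gt0 cabs_real gtr0_norm.
have mem : eigenvalue (mu_mx r A s) ((k0 * (2 - a ^+ 2))%:C)%C.
  apply/eigenvalue_mu; exists 1, 0, (-1); rewrite oner_neq0; split=> //=.
  have -> : ((k0 * (2 - a ^+ 2))%:C)%C / (k0%:C)%C - 2 = - (a%:C)%C ^+ 2 :> R[i].
    rewrite (rmorphM _ k0) rmorphB rmorphXn /= rmorph_nat.
    by field.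
  by split; ring.
have lb : lbound [set x : R | eigenvalue (mu_mx r A s) (x%:C)%C] (k0 * (2 - a ^+ 2)).
  move=> x /= /eigenvalue_mu[u0 [u1 [u2 [un0]]]].
  pose k : R := x / k0 - 2.
  have -> : (x%:C)%C / (k0%:C)%C - 2 = (k%:C)%C :> R[i].
    by rewrite /k rmorphB fmorph_div rmorph_nat.
  have kE : k = x / k0 - 2 by [].
  clearbody k; move=> [e0 e1 e2].
  suff : - a ^+ 2 <= k.
    by rewrite kE lerBrDr addrC ler_pdivlMr // mulrC.
  rewrite leNgt; apply/negP => ka.
  have ka0 : (k%:C)%C + (a%:C)%C ^+ 2 != 0 :> R[i].
    rewrite -rmorphXn -rmorphD -cabs_gt0 cabs_real normr_gt0 lt_eqF //.
    by move: ka; lra.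
  have u02 : u0 = u2.
    apply/eqP; rewrite -subr_eq0 -(mulrI_eq0 _ (mulfI ka0)); apply/eqP.
    have -> : ((k%:C)%C + (a%:C)%C ^+ 2) * (u0 - u2) =
      (k%:C)%C * u0 - (k%:C)%C * u2 + (a%:C)%C ^+ 2 * (u0 - u2) by ring.
    by rewrite -e0 -e2; ring.
  rewrite -u02 in e0 e1 e2 un0.
  have u00 : u0 != 0.
    apply: contraTneq un0 => u00; rewrite u00 in e0 *.
    move: e0; rewrite !mulr0 addr0 => /eqP; rewrite mulf_eq0 (negPf b0) /= => /eqP ->.
    by rewrite eqxx.
  have : ((k * (k - a ^+ 2))%:C)%C = ((2 * a ^+ 2)%:C)%C :> R[i].
    apply: (mulIf u00).
    rewrite (rmorphM _ k) rmorphB (rmorphM _ 2) rmorphXn /= rmorph_nat.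
    have -> : (k%:C)%C * ((k%:C)%C - (a%:C)%C ^+ 2) * u0 =
      (k%:C)%C * ((k%:C)%C * u0 - (a%:C)%C ^+ 2 * u0) by ring.
    rewrite -e0.
    have -> : (k%:C)%C * ((a%:C)%C * u1 + (a%:C)%C ^+ 2 * u0 - (a%:C)%C ^+ 2 * u0) =
      (a%:C)%C * ((k%:C)%C * u1) by ring.
    by rewrite -e1; ring.
  move=> /complexI E.
  have a2 : 1 <= a ^+ 2 by rewrite exprn_ege1.
  by move: (a ^+ 2) a2 ka E => c c1 kc; nra.
apply/eqP; rewrite eq_le; apply/andP; split.
  by apply: ge_inf => //; exists (k0 * (2 - a ^+ 2)).
by apply: lb_le_inf => //; exists (k0 * (2 - a ^+ 2)).
Qed.

Lemma delta_jordan3 : 2 + delta r A = (r ^+ 2)^-1.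
Proof.
rewrite /delta; under eq_Rintegral do rewrite lambda_min_mu.
have P0 : 0 < 2 * pi * r by rewrite !mulr_gt0 // pi_gt0.
have L : lebesgue_measure ([set` `[0, 2 * pi * r]%R] : set R) = (2 * pi * r)%:E.
  by rewrite lebesgue_measure_itv /= lte_fin P0 sube0.
rewrite Rintegral_cst // [X in fine X](_ : _ = (2 * pi * r)%:E) //= /k0 /a.
by move: (2 * pi * r) P0 => P P0; field; rewrite !gt_eqF.
Qed.

End SmallestEigenvalue.

Unset Implicit Arguments.

Theorem theorem3 (R : realType) (r : R) (hr0 : 0 < r) (hr1 : r <= 1) :
  let A : 'M[R[i]]_3 := jordan_block 3 0 in
  let d := delta r A in
  (forall f : R[i]^o -> R[i]^o,
      admissible r f -> (exists z, cdisk r z /\ f z != 0) ->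
      opnorm (matfun_jordan f 3 0) / supnorm r f <= 2 + d) /\
  (exists f : R[i]^o -> R[i]^o,
      [/\ admissible r f, (exists z, cdisk r z /\ f z != 0) &
          opnorm (matfun_jordan f 3 0) / supnorm r f = 2 + d]).
Proof.
move=> A d; have dE : 2 + d = (r ^+ 2)^-1 by exact: delta_jordan3.
rewrite dE; split=> [f [df _] _|]; first exact: opnorm_div_supnorm_le.
exists (fun z => z ^+ 2); split; first exact: admissible_sqr.
- exists (r%:C)%C; rewrite /cdisk /= cabs_real gtr0_norm //; split=> //.
  by rewrite expf_neq0 // -cabs_gt0 cabs_real gtr0_norm.
- by rewrite opnorm_sqr supnorm_sqr // div1r.
Qed.
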